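(* Let $C$ be an algebraically closed field of characteristic zero, let $R_1=C\{t_1,\dots,t_l\}$ be the differential polynomial ring in differential indeterminates $t_1,\dots,t_l$ over $C$, contained in its fraction field $F_1=C\langle t_1,\dots,t_l\rangle$, and let $R_2=C[z]\subset F_2=C(z)$ with derivation $\frac{d}{dz}$. Let $A(\mathbf{t})\in R_1^{n\times n}$ and let $\sigma:R_1\to R_2$ be a surjective specialization. Then the differential Galois group over $F_2$ of the specialized equation $\partial(\mathbf{y})=A(\sigma(\mathbf{t}))\mathbf{y}$ is a subgroup of the differential Galois group over $F_1$ of $\partial(\mathbf{y})=A(\mathbf{t})\mathbf{y}$.
   Context: A specialization $\sigma:R_1\to R_2$ is a differential $C$-algebra homomorphism, determined by the images $\sigma(t_i)\in R_2$; $A(\sigma(\mathbf{t}))$ denotes the matrix obtained by applying $\sigma$ entrywise. *)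

(* Defs.v *)
From HB Require Import structures.
From mathcomp Require Import all_boot all_order all_algebra.
Set Implicit Arguments. Unset Strict Implicit. Unset Printing Implicit Defensive.
Import Order.TTheory GRing.Theory.
Local Open Scope ring_scope.

Definition isDerivation (R : nzRingType) (d : R -> R) : Prop :=
  (forall x y, d (x + y) = d x + d y) /\ (forall x y, d (x * y) = d x * y + x * d y).

Definition diff_C_alg (C : fieldType) (R : comNzRingType) (cR : C -> R) (dR : R -> R) : Prop :=
  isDerivation dR /\ (forall c, dR (cR c) = 0).

Definition diff_C_hom (C : fieldType) (R S : nzRingType) (cR : C -> R) (cS : C -> S)
  (dR : R -> R) (dS : S -> S) (f : R -> S) : Prop :=
  (forall c, f (cR c) = cS c) /\ (forall x, f (dR x) = dS (f x)).

(* R = C{t_1,...,t_l}: the differential polynomial ring in the differential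
   indeterminates t, characterized by its universal property (free commutative
   differential C-algebra on t). *)
Definition is_diff_poly_ring (C : fieldType) (l : nat) (R : comNzRingType)
  (cR : {rmorphism C -> R}) (dR : R -> R) (t : 'I_l -> R) : Prop :=
  diff_C_alg cR dR /\
  forall (S : comNzRingType) (cS : {rmorphism C -> S}) (dS : S -> S),
    diff_C_alg cS dS -> forall s : 'I_l -> S,
      (exists f : {rmorphism R -> S}, diff_C_hom cR cS dR dS f /\ forall i, f (t i) = s i) /\
      (forall f g : {rmorphism R -> S},
          diff_C_hom cR cS dR dS f -> (forall i, f (t i) = s i) ->
          diff_C_hom cR cS dR dS g -> (forall i, g (t i) = s i) ->
          forall x, f x = g x).

Definition is_diff_frac_field (R : nzRingType) (F : fieldType) (dR : R -> R) (dF : F -> F)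
  (i : {rmorphism R -> F}) : Prop :=
  isDerivation dF /\ injective i /\ (forall x, i (dR x) = dF (i x)) /\
  (forall x : F, exists a b : R, b != 0 /\ x = i a / i b).

Definition is_PV (F : fieldType) (dF : F -> F) (n : nat) (A : 'M[F]_n)
  (E : fieldType) (dE : E -> E) (j : {rmorphism F -> E}) (Y : 'M[E]_n) : Prop :=
  [/\ isDerivation dE /\ (forall f, j (dF f) = dE (j f)),
      Y \in unitmx,
      map_mx dE Y = map_mx j A *m Y,
      (forall e, dE e = 0 -> exists f, dF f = 0 /\ e = j f)
    & (* E is generated as a field over j(F) by the entries of Y *)
      (forall P : E -> Prop,
          (forall f, P (j f)) -> (forall a b, P (Y a b)) ->
          (forall x y, P x -> P y -> P (x + y)) -> (forall x, P x -> P (- x)) ->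
          (forall x y, P x -> P y -> P (x * y)) -> (forall x, P x -> P (x^-1)) ->
          forall e, P e)].

(* M (a matrix with entries in the constants C, embedded into F by cF) belongs
   to the differential Galois group of E/F, represented in GL_n(C) with respect
   to the fundamental matrix Y: there is a differential F-automorphism phi of E
   with phi(Y) = Y M. *)
Definition in_gal (C : fieldType) (F : fieldType) (cF : C -> F) (n : nat)
  (E : fieldType) (dE : E -> E) (j : {rmorphism F -> E}) (Y : 'M[E]_n) (M : 'M[C]_n) : Prop :=
  exists phi : {rmorphism E -> E},
    [/\ bijective phi, (forall f, phi (j f) = j f), (forall e, phi (dE e) = dE (phi e))
      & map_mx phi Y = Y *m map_mx (fun c => j (cF c)) M].

(* Main.v *)
(* Let I be the ideal of relations over R = C{t} of a fundamental matrix Y1. All the partial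
   derivations of R (with respect to the derivatives of the t_j) extend to R[X] so that their
   commutators with the derivation X' = A X are again of this form; they preserve I, since they
   do for large index. Hence the quotient R[X]/I carries a connection over R in all these
   directions, and as R has no nontrivial ideal stable under all partial derivations, nothing
   degenerates under specialization: det(X) is not nilpotent modulo sigma(I), and an ideal
   strictly containing I and stable under all derivations contains a power of det(X). By descent
   of constants and the Nullstellensatz there is P in GL_n(C) with (sigma q)(Y2 P) = 0 for q in I.
   The group of Y1 is the set of M with q(Y1 M) = 0 for all q in I, cut out by polynomials p(M)
   for which some det(Z)^m p(X) lies in the ideal of R[Z][X] generated by I and the q(ZX).
   Specializing Z to Y2 P and X to P^-1 M P, for M in the group of Y2, gives p(P^-1 M P) = 0. *)

Require Import Defs.
From HB Require Import structures.
From mathcomp Require Import all_boot all_order all_algebra.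
From mathcomp Require Import mpoly ring.
From mathcomp Require boolp classical_sets.
From Stdlib Require Import ClassicalEpsilon.
Set Implicit Arguments. Unset Strict Implicit. Unset Printing Implicit Defensive.
Import GRing.Theory.
Local Open Scope ring_scope.

(** The obstacle is that the kernel of sigma is itself an ideal of R stable under the given
    derivation, so stability under that derivation alone cannot stop a relation or a denominator
    from degenerating. Stability under all partial derivations does: in characteristic zero such a
    nonzero ideal contains 1, and 1 survives every sigma. Each possible degeneration is therefore
    encoded as an ideal of R, and that ideal is shown to be stable. The partial derivation of index
    k is the commutator of the one of index k+1 with the derivation of R, and for large k it kills
    any given finite set of coefficients; this starts the descending inductions. In general R is not
    Noetherian, so linear algebra in R[X] is done in bounded degree, which X' = B X respects, by
    means of functionals and common denominators. The matrix P is there because both groups are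
    written with respect to chosen fundamental matrices, so that an inclusion can only be expected
    up to conjugation. *)

Lemma minimizer_exists T (f : T -> nat) (P : T -> Prop) :
  (exists x, P x) -> exists2 x, P x & forall y, P y -> (f x <= f y)%N.
Proof.
case=> x; have [n] := ubnP (f x); elim: n x => // n IH x le Px.
have [[y [Py lt]]|h] := classic (exists y, P y /\ (f y < f x)%N).
  by apply: (IH y) => //; apply: leq_trans lt _.
by exists x => // y Py; rewrite leqNgt; apply/negP => lt; apply: h; exists y.
Qed.

(** * Derivations *)

(** With [f := id] this unfolds to [isDerivation], so ordinary derivations and those with values in
    another ring share the lemmas below. *)
Definition derivation_along (R S : nzRingType) (f D : R -> S) : Prop :=
  (forall x y, D (x + y) = D x + D y) /\
  (forall x y, D (x * y) = D x * f y + f x * D y).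

Section Derivation.
Variables (R S : nzRingType) (f D : R -> S).
Hypothesis hD : derivation_along f D.

Lemma derD x y : D (x + y) = D x + D y. Proof. exact: hD.1. Qed.
Lemma derM x y : D (x * y) = D x * f y + f x * D y. Proof. exact: hD.2. Qed.

Lemma der0 : D 0 = 0.
Proof. by apply: (@addrI _ (D 0)); rewrite -derD !addr0. Qed.

Lemma derN x : D (- x) = - D x.
Proof. by apply: (@addrI _ (D x)); rewrite -derD !subrr der0. Qed.

Lemma derMn x m : D (x *+ m) = D x *+ m.
Proof. by elim: m => [|m IH]; rewrite ?mulr0n ?der0 // !mulrSr derD IH. Qed.

Lemma der_sum I r (P : pred I) F :
  D (\sum_(i <- r | P i) F i) = \sum_(i <- r | P i) D (F i).
Proof. exact: (big_morph D derD der0). Qed.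

Lemma der1 : f 1 = 1 -> D 1 = 0.
Proof.
move=> f1; have := derM 1 1; rewrite mulr1 f1 mulr1 mul1r => h.
by apply: (@addrI _ (D 1)); rewrite addr0.
Qed.
End Derivation.

Section MpolyGen.
Variables (N : nat) (R : nzRingType).

Lemma mpoly_gen (P : {mpoly R[N]} -> Prop) :
  (forall c, P c%:MP) -> (forall i, P 'X_i) ->
  (forall p q, P p -> P q -> P (p + q)) ->
  (forall p q, P p -> P q -> P (p * q)) -> forall p, P p.
Proof.
move=> PC PX PD PM; elim/mpolyind=> [|c m p _ _ Pp]; first by rewrite -mpolyC0.
apply: PD => //; rewrite -mul_mpolyC; apply: (PM) => //.
rewrite mpolyXE_id; apply: (big_ind P) => [|x y|i _]; [by rewrite -mpolyC1 | exact: PM |].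
by elim: (m i) => [|k IH]; rewrite ?expr0 -?mpolyC1 // exprS; apply: PM.
Qed.

Lemma mpoly_der_ext (S : nzRingType) (f D1 D2 : {mpoly R[N]} -> S) :
  derivation_along f D1 -> derivation_along f D2 ->
  (forall c, D1 c%:MP = D2 c%:MP) -> (forall i, D1 'X_i = D2 'X_i) -> D1 =1 D2.
Proof.
move=> h1 h2 hC hX; apply: mpoly_gen => // p q hp hq.
  by rewrite (derD h1) (derD h2) hp hq.
by rewrite (derM h1) (derM h2) hp hq.
Qed.

Lemma mpoly_rmorph_ext (S : nzRingType) (f g : {rmorphism {mpoly R[N]} -> S}) :
  (forall c, f c%:MP = g c%:MP) -> (forall i, f 'X_i = g 'X_i) -> f =1 g.
Proof.
by move=> hC hX; apply: mpoly_gen => // p q hp hq;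
  rewrite ?rmorphD ?rmorphM hp hq.
Qed.
End MpolyGen.

Section Dcoef.
Variables (N : nat) (R : comNzRingType).
Implicit Types (d : R -> R) (p q : {mpoly R[N]}).

Definition dcoef d p : {mpoly R[N]} := \sum_(m <- msupp p) d p@_m *: 'X_[m].

Lemma mcoeff_dcoef d p m : isDerivation d -> (dcoef d p)@_m = d p@_m.
Proof.
move=> hd; rewrite /dcoef raddf_sum /=.
under eq_bigr => k _ do rewrite mcoeffZ mcoeffX.
have [hm|hm] := boolP (m \in msupp p).
  rewrite (bigD1_seq m) ?msupp_uniq //= eqxx mulr1 big1 ?addr0 // => k.
  by move/negbTE => ->; rewrite mulr0.
rewrite big1_seq => [|k /andP[_ hk]].
  by rewrite (memN_msupp_eq0 hm) (der0 (f := id) hd).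
by case: eqP hk hm => [->->|]; rewrite ?mulr0.
Qed.

Lemma dcoef_der d : isDerivation d -> isDerivation (dcoef d).
Proof.
move=> hd; split=> p q; apply/mpolyP => m.
  by rewrite mcoeffD !mcoeff_dcoef // mcoeffD (derD (f := id) hd).
rewrite mcoeffD mcoeff_dcoef // !mcoeffM (der_sum (f := id) hd) -big_split /=.
by apply: eq_bigr => k _; rewrite !mcoeff_dcoef // (derM (f := id) hd).
Qed.

Lemma dcoefC d c : isDerivation d -> dcoef d c%:MP = (d c)%:MP.
Proof.
move=> hd; apply/mpolyP => m; rewrite mcoeff_dcoef // !mcoeffC.
by case: eqP; rewrite ?mulr1 ?mulr0 ?(der0 (f := id) hd).
Qed.

Lemma dcoefX d m : isDerivation d -> dcoef d 'X_[m] = 0.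
Proof.
move=> hd; apply/mpolyP => k; rewrite mcoeff_dcoef // mcoeffX mcoeff0.
by case: eqP => _; rewrite ?(der1 (f := id) hd) ?(der0 (f := id) hd).
Qed.
End Dcoef.

Section DerivationPower.
Variables (R : comNzRingType) (D : R -> R).
Hypothesis hD : isDerivation D.
Let hD' : derivation_along id D := hD.

Lemma derX x m : D (x ^+ m) = x ^+ m.-1 * D x *+ m.
Proof.
elim: m => [|m IH]; first by rewrite expr0 (der1 hD').
rewrite exprS (derM hD') IH /= mulrC -mulrnAr mulrS; congr (_ + _).
case: m {IH} => [|m]; first by rewrite mulr0n !mulr0.
by rewrite /= !mulrnAr mulrA -exprS.
Qed.

Lemma der_sign m : D ((-1) ^+ m) = 0.
Proof. by rewrite derX (derN hD') (der1 hD') ?oppr0 ?mulr0 ?mul0rn. Qed.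

Lemma der_prod (I : finType) (F : I -> R) :
  D (\prod_i F i) = \sum_i D (F i) * \prod_(j | j != i) F j.
Proof.
suff h (r : seq I) : uniq r -> D (\prod_(i <- r) F i) =
    \sum_(i <- r) D (F i) * \prod_(j <- r | j != i) F j by apply/h/index_enum_uniq.
elim: r => [|a r IH] /=; first by rewrite !big_nil (der1 hD').
case/andP=> ar ur; rewrite !big_cons eqxx (derM hD') IH //; congr (_ + _).
  congr (_ * _); rewrite big_seq [RHS]big_seq_cond; apply: eq_bigl => j.
  by case: (boolP (j \in r)) => //= jr; apply/esym; apply: contraNneq ar => <-.
rewrite mulr_sumr big_seq [RHS]big_seq; apply: eq_bigr => i ir.
rewrite big_cons; have -> : a != i by apply: contraNneq ar => ->.
by rewrite mulrCA.
Qed.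

(** Jacobi's formula: differentiating one row at a time gives a sum of determinants, and expanding
    each along its differentiated row produces the adjugate. *)
Lemma der_det n (M : 'M[R]_n) : D (\det M) = \tr (map_mx D M *m \adj M).
Proof.
rewrite /determinant (der_sum hD').
transitivity (\sum_i \det (\matrix_(k, j) (if k == i then D (M k j) else M k j))).
  rewrite exchange_big /=; apply: eq_bigr => s _.
  rewrite (derM hD') der_sign mul0r add0r.
  rewrite der_prod mulr_sumr; apply: eq_bigr => i _; congr (_ * _).
  rewrite [RHS](bigD1 i) //= mxE eqxx; congr (_ * _); apply: eq_bigr => j /negbTE ji.
  by rewrite mxE ji.
apply: eq_bigr => i _; rewrite mxE (expand_det_row _ i); apply: eq_bigr => j _.
rewrite !mxE eqxx; congr (_ * _); rewrite /cofactor; congr (_ * \det _).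
by apply/matrixP => a b; rewrite !mxE eq_sym (negbTE (neq_lift _ _)).
Qed.

(** Liouville's formula. Because of it, powers of det X span a line stable under every system X' = B
    X. *)
Lemma der_det_linear n (M B : 'M[R]_n) :
  map_mx D M = B *m M -> D (\det M) = \tr B * \det M.
Proof.
by move=> h; rewrite der_det h -mulmxA mul_mx_adj mul_mx_scalar mxtraceZ mulrC.
Qed.
End DerivationPower.

Lemma commutator_der (R : comNzRingType) (d1 d2 : R -> R) :
  isDerivation d1 -> isDerivation d2 -> isDerivation (fun x => d1 (d2 x) - d2 (d1 x)).
Proof.
move=> h1 h2; split=> x y.
  by rewrite !((derD (f := id) h1), (derD (f := id) h2)); ring.
by rewrite !((derM (f := id) h1), (derM (f := id) h2),
            (derD (f := id) h1), (derD (f := id) h2)); ring.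
Qed.

Lemma map_mx_derM (R : nzRingType) (D : R -> R) m n p (A : 'M[R]_(m, n)) (B : 'M_(n, p)) :
  isDerivation D -> map_mx D (A *m B) = map_mx D A *m B + A *m map_mx D B.
Proof.
move=> hD; apply/matrixP => i j; rewrite !mxE (der_sum (f := id) hD) -big_split /=.
by apply: eq_bigr => k _; rewrite !mxE (derM (f := id) hD).
Qed.


(** The commutator of two linear systems on the same X is linear again, with matrix d1 B2 - d2 B1 +
    B2 B1 - B1 B2; this expression later dictates the recursion for the matrices [B j k]. *)
Lemma commutator_linear_system (R S : comNzRingType) (f : {rmorphism R -> S})
    (d1 d2 : R -> R) (D1 D2 : S -> S) n (X : 'M[S]_n) (B1 B2 : 'M[R]_n) :
  isDerivation D1 -> isDerivation D2 ->
  (forall x, D1 (f x) = f (d1 x)) -> (forall x, D2 (f x) = f (d2 x)) ->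
  map_mx D1 X = map_mx f B1 *m X -> map_mx D2 X = map_mx f B2 *m X ->
  forall i j, D1 (D2 (X i j)) - D2 (D1 (X i j)) =
  (map_mx f (map_mx d1 B2 + B2 *m B1 - map_mx d2 B1 - B1 *m B2) *m X) i j.
Proof.
move=> h1 h2 hf1 hf2 e1 e2 i j.
suff /matrixP/(_ i j) : map_mx D1 (map_mx D2 X) - map_mx D2 (map_mx D1 X) =
    map_mx f (map_mx d1 B2 + B2 *m B1 - map_mx d2 B1 - B1 *m B2) *m X by rewrite !mxE.
move: h1 h2 hf1 hf2 e1 e2.
move=> h1 h2 hf1 hf2 e1 e2; rewrite e1 e2 !map_mx_derM // e1 e2 !mulmxA -!mulmxDl -mulmxBl.
have comm D d (M : 'M[R]_n) : (forall x, D (f x) = f (d x)) ->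
    map_mx D (map_mx f M) = map_mx f (map_mx d M).
  by move=> h; rewrite -!map_mx_comp; apply: eq_map_mx.
rewrite (comm _ _ _ hf1) (comm _ _ _ hf2) -!map_mxM -!map_mxD -map_mxB.
by rewrite opprD addrA.
Qed.

(** * Polynomials in the entries of a generic matrix, evaluation, and linear differential systems *)

Section GenericMatrix.
Variable n : nat.

Definition varmx (R : comNzRingType) : 'M[{mpoly R[n * n]}]_n := vec_mx (\row_k 'X_k).

Definition mxeval (R S : comNzRingType) (f : {rmorphism R -> S}) (W : 'M[S]_n)
  : {mpoly R[n * n]} -> S := mmap f (fun k => mxvec W 0 k).
HB.instance Definition _ R S f W :=
  GRing.RMorphism.copy (@mxeval R S f W) (mmap f (fun k => mxvec W 0 k)).

Lemma mxeval_C R S f W c : @mxeval R S f W c%:MP = f c.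
Proof. exact: mmapC. Qed.

Lemma mxeval_X R S f W k : @mxeval R S f W 'X_k = mxvec W 0 k.
Proof. by rewrite /mxeval mmapX mmap1U. Qed.

Lemma varmxE R i j : varmx R i j = 'X_(mxvec_index i j).
Proof. by rewrite !mxE. Qed.

Lemma varmxX R k : 'X_k = mxvec (varmx R) 0 k.
Proof. by rewrite /varmx vec_mxK mxE. Qed.

Lemma mxeval_gen R S f W : map_mx (@mxeval R S f W) (varmx R) = W.
Proof. by apply/matrixP => i j; rewrite mxE varmxE mxeval_X mxvecE. Qed.

Lemma mxeval_det R S f W m : @mxeval R S f W (\det (varmx R) ^+ m) = \det W ^+ m.
Proof. by rewrite rmorphXn -det_map_mx mxeval_gen. Qed.

Lemma mxeval_unique (R S : comNzRingType) (f : {rmorphism R -> S}) (W : 'M[S]_n)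
    (h : {rmorphism {mpoly R[n * n]} -> S}) :
  (forall c, h c%:MP = f c) -> map_mx h (varmx R) = W -> h =1 mxeval f W.
Proof.
move=> hC hW; apply: mpoly_rmorph_ext => [c|k] /=; first by rewrite mxeval_C.
by rewrite mxeval_X -hW -map_mxvec mxE -varmxX.
Qed.

Lemma mxeval_comp (R S T : comNzRingType) (f : {rmorphism R -> S})
    (g : {rmorphism S -> T}) (W : 'M[S]_n) q :
  g (mxeval f W q) = mxeval (g \o f) (map_mx g W) q.
Proof.
apply: (@mxeval_unique _ _ _ _ (g \o mxeval f W)) => [c|] /=; first by rewrite mxeval_C.
by rewrite map_mx_comp mxeval_gen.
Qed.

Lemma mxeval_eq (R S : comNzRingType) (f g : {rmorphism R -> S}) (W : 'M[S]_n) :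
  f =1 g -> mxeval f W =1 mxeval g W.
Proof.
move=> fg; apply: mxeval_unique => [c|] /=; first by rewrite mxeval_C.
exact: mxeval_gen.
Qed.

(* The derivation extending d on the coefficients, with X' = B X for the generic matrix X. *)
Definition lder (R : comNzRingType) (d : R -> R) (B : 'M[R]_n) (q : {mpoly R[n * n]}) :=
  dcoef d q + \sum_k mxvec (map_mx (@mpolyC _ R) B *m varmx R) 0 k * q^`M(k).

Section Lder.
Variables (R : comNzRingType) (d : R -> R) (B : 'M[R]_n).
Hypothesis hd : isDerivation d.

Lemma lder_der : isDerivation (lder d B).
Proof.
split=> p q; rewrite /lder.
  rewrite (derD (f := id) (dcoef_der _ hd)) addrACA -big_split; congr (_ + _).
  by apply: eq_bigr => k _; rewrite mderivD mulrDr.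
rewrite (derM (f := id) (dcoef_der _ hd)) mulrDl mulrDr addrACA; congr (_ + _).
rewrite mulr_suml mulr_sumr -big_split; apply: eq_bigr => k _ /=.
by rewrite mderivM mulrDr [p * (_ * _)]mulrCA !mulrA.
Qed.
Let hD : derivation_along id (lder d B) := lder_der.

Lemma lderC c : lder d B c%:MP = (d c)%:MP.
Proof.
by rewrite /lder dcoefC // big1 ?addr0 // => k _; rewrite mderivC mulr0.
Qed.

Lemma lderX k : lder d B 'X_k = mxvec (map_mx (@mpolyC _ R) B *m varmx R) 0 k.
Proof.
rewrite /lder dcoefX // add0r (bigD1 k) //= mderivX mnm1E eqxx scale1r.
rewrite (_ : (U_(k) - U_(k))%MM = 0%MM) ?mpolyX0 ?mulr1; last first.
  by apply/mnmP => i; rewrite mnmBE subnn mnm0E.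
by rewrite big1 ?addr0 // => j /negbTE jk; rewrite mderivX mnm1E eq_sym jk scale0r mulr0.
Qed.

Lemma lder_gen : map_mx (lder d B) (varmx R) = map_mx (@mpolyC _ R) B *m varmx R.
Proof. by apply/matrixP => i j; rewrite mxE varmxE lderX mxvecE. Qed.

Lemma lder_det m :
  lder d B (\det (varmx R) ^+ m) = (\tr B *+ m)%:MP * \det (varmx R) ^+ m.
Proof.
rewrite (derX lder_der) (der_det_linear lder_der lder_gen) trace_map_mx.
case: m => [|m]; first by rewrite !mulr0n mul0r.
by rewrite /= mulrCA -exprSr raddfMn mulrnAl.
Qed.

Lemma lder0 q : lder d 0 q = dcoef d q.
Proof.
rewrite /lder big1 ?addr0 // => k _.
by case/mxvec_indexP: k => i j; rewrite mxvecE map_mx0 mul0mx mxE mul0r.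
Qed.

(** A variable lost by differentiation is replaced by a linear form, an entry of B X. Hence each
    piece of bounded degree is stable, which makes finite-dimensional arguments possible. *)
Lemma msize_lder K q : (msize q <= K)%N -> (msize (lder d B q) <= K)%N.
Proof.
move=> hq; rewrite (@mpolywE _ _ K q hq) (der_sum hD).
apply: leq_trans (msize_sum _ _ _) _; apply/bigmax_leqP_seq => m _ _.
rewrite -mul_mpolyC (derM hD) lderC.
apply: leq_trans (msizeD_le _ _) _; rewrite geq_max mul_mpolyC.
apply/andP; split.
  by apply: leq_trans (msizeZ_le _ _) _; rewrite msizeX bmdeg.
rewrite mul_mpolyC; apply: leq_trans (msizeZ_le _ _) _.
rewrite /lder dcoefX // add0r; apply: leq_trans (msize_sum _ _ _) _.
apply/bigmax_leqP_seq => k _ _; rewrite mderivX.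
have [mk0|mk0] := eqVneq (m k) 0%N; first by rewrite mk0 scale0r mulr0 msize0.
rewrite -scalerAr; apply: leq_trans (msizeZ_le _ _) _.
case/mxvec_indexP: k mk0 => i j mk0; rewrite mxvecE mxE mulr_suml.
apply: leq_trans (msize_sum _ _ _) _; apply/bigmax_leqP_seq => k _ _.
rewrite mxE varmxE -mulrA mul_mpolyC; apply: leq_trans (msizeZ_le _ _) _.
rewrite -mpolyXD msizeX mdegD mdeg1 add1n.
have h : (U_(mxvec_index i j) <= m)%MM.
  apply/mnm_lepP => a; rewrite mnm1E.
  by case: eqP => [<-|//]; rewrite lt0n.
have := congr1 mdeg (submK h); rewrite mdegD mdeg1 addn1 => ->.
exact: bmdeg.
Qed.
End Lder.

(** Both sides are derivations along the evaluation and agree on coefficients and variables.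
    Consequently the relations of a solution form an ideal stable under [lder]. *)
Lemma lder_eval (R S : comNzRingType) (f : {rmorphism R -> S}) d B D (W : 'M[S]_n) :
  isDerivation d -> isDerivation D -> (forall x, D (f x) = f (d x)) ->
  map_mx D W = map_mx f B *m W ->
  forall q, D (mxeval f W q) = mxeval f W (lder d B q).
Proof.
move=> hd hD fd hW.
apply: (@mpoly_der_ext _ _ _ (mxeval f W)) => [||c|k].
- split=> x y; first by rewrite rmorphD (derD (f := id) hD).
  by rewrite rmorphM (derM (f := id) hD).
- have hl := lder_der B hd; split=> x y.
    by rewrite (derD (f := id) hl) rmorphD.
  by rewrite (derM (f := id) hl) rmorphD !rmorphM.
- by rewrite lderC // !mxeval_C.
rewrite lderX // mxeval_X; transitivity (mxvec (map_mx D W) 0 k); first by rewrite -map_mxvec mxE.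
transitivity (mxvec (map_mx (mxeval f W) (map_mx (@mpolyC _ R) B *m varmx R)) 0 k).
  rewrite hW map_mxM mxeval_gen -map_mx_comp; congr (mxvec (_ *m _) 0 k).
  by apply: eq_map_mx => c /=; rewrite mxeval_C.
by rewrite -map_mxvec mxE.
Qed.

Opaque lder.

Lemma lder_commutator (R : comNzRingType) d0 d1 d2 (B0 B1 B2 : 'M[R]_n) :
  isDerivation d0 -> isDerivation d1 -> isDerivation d2 ->
  (forall x, d0 x = d1 (d2 x) - d2 (d1 x)) ->
  B0 = map_mx d1 B2 + B2 *m B1 - map_mx d2 B1 - B1 *m B2 ->
  forall q, lder d0 B0 q = lder d1 B1 (lder d2 B2 q) - lder d2 B2 (lder d1 B1 q).
Proof.
move=> h0 h1 h2 hc hB.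
have [l0 [l1 l2]] := (lder_der B0 h0, (lder_der B1 h1, lder_der B2 h2)).
have l3 := commutator_der l1 l2.
apply: (mpoly_der_ext (f := id) (l0 : derivation_along _ _) (l3 : derivation_along _ _)) => [c|k].
  by rewrite !lderC // hc mpolyCB.
have h := commutator_linear_system l1 l2 (fun c => lderC B1 h1 c)
  (fun c => lderC B2 h2 c) (lder_gen B1 h1) (lder_gen B2 h2).
case/mxvec_indexP: k => i j; rewrite (lderX B0 h0) mxvecE hB -[in RHS]varmxE.
exact/esym/h.
Qed.
End GenericMatrix.
Opaque mxeval.
(** * Ideals *)

Section Ideals.
Variable R : comNzRingType.

Definition is_ideal (I : R -> Prop) :=
  [/\ I 0, forall x y, I x -> I y -> I (x + y) & forall a x, I x -> I (a * x)].

Lemma idealN I x : is_ideal I -> I x -> I (- x).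
Proof. by case=> _ _ hM hx; rewrite -mulN1r; apply: hM. Qed.

Lemma idealB I x y : is_ideal I -> I x -> I y -> I (x - y).
Proof. by move=> hI hx hy; case: (hI) => _ hD _; apply: hD => //; apply: idealN. Qed.

Lemma ideal_sum I (T : Type) (r : seq T) (P : pred T) (F : T -> R) :
  is_ideal I -> (forall i, P i -> I (F i)) -> I (\sum_(i <- r | P i) F i).
Proof. by case=> h0 hD _ h; apply: big_ind. Qed.

(** Encoded as the intersection of all ideals containing the generators: a membership is used by
    supplying a suitable ideal, never by writing out a combination. *)
Definition gen_ideal (T : Type) (f : T -> R) (Q : T -> Prop) (v : R) : Prop :=
  forall I, is_ideal I -> (forall a, Q a -> I (f a)) -> I v.

Lemma gen_idealP T f (Q : T -> Prop) : is_ideal (gen_ideal f Q).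
Proof.
split=> [I [] // | x y hx hy I hI hQ | a x hx I hI hQ].
  by case: (hI) => _ hD _; apply: hD; [apply: hx | apply: hy].
by case: (hI) => _ _; apply; apply: hx.
Qed.

Lemma gen_ideal_in T f (Q : T -> Prop) a : Q a -> gen_ideal f Q (f a).
Proof. by move=> ha I _; apply. Qed.

Lemma gen_ideal_der T f (Q : T -> Prop) (D : R -> R) : isDerivation D ->
  (forall a, Q a -> gen_ideal f Q (D (f a))) ->
  forall v, gen_ideal f Q v -> gen_ideal f Q (D v).
Proof.
(* The condition on [D v] alone is not closed under multiples; by the Leibniz rule the conjunction
   is. *)
move=> hD hQ v hv; suff [] : gen_ideal f Q v /\ gen_ideal f Q (D v) by [].
have [h0 hA hM] := gen_idealP f Q.
apply: (hv (fun v => _ /\ _)) => [|a ha]; last first.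
  by split; [apply: gen_ideal_in | apply: hQ].
split=> [|x y [hx hx'] [hy hy']|a x [hx hx']].
- by rewrite (der0 (f := id) hD).
- by rewrite (derD (f := id) hD); split; apply: hA.
- rewrite (derM (f := id) hD); split; first exact: hM.
  by apply: hA; apply: hM.
Qed.

End Ideals.

Lemma gen_ideal_map (R S : comNzRingType) (h : {rmorphism R -> S}) (J : S -> Prop)
    T (f : T -> R) (Q : T -> Prop) : is_ideal J ->
  (forall a, Q a -> J (h (f a))) -> forall v, gen_ideal f Q v -> J (h v).
Proof.
move=> [h0 hA hM] hQ v hv; apply: (hv (fun x => J (h x))) => //; split=> [|x y|a x].
- by rewrite rmorph0.
- by rewrite rmorphD; apply: hA.
- by rewrite rmorphM; apply: hM.
Qed.

Lemma zero_ideal (R : comNzRingType) : is_ideal (fun x : R => x = 0).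
Proof. by split=> [|x y -> ->|a x ->]; rewrite ?addr0 ?mulr0. Qed.

Section SubringOfPredicate.
Variables (R : comNzRingType) (P : R -> Prop).

Definition pred_of_prop : {pred R} := fun x => boolp.asbool (P x).
Hypothesis hP : subring_closed pred_of_prop.

(* The dummy dependence on hP lets unification recover the closure proof from the type. *)
Definition closed_pred : {pred R} := let _ := hP in pred_of_prop.
HB.instance Definition _ := GRing.isSubringClosed.Build R closed_pred hP.

Record prop_subring := PropSubring
  { prop_subring_val :> R; _ : prop_subring_val \in closed_pred }.
HB.instance Definition _ := [isSub for prop_subring_val].
HB.instance Definition _ := [Choice of prop_subring by <:].
HB.instance Definition _ := [SubChoice_isSubComNzRing of prop_subring by <:].
End SubringOfPredicate.

(** * Structural induction for differential polynomials *)

Section DiffPolyInduction.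
Variables (C : fieldType) (l : nat) (R : comNzRingType).
Variables (cR : {rmorphism C -> R}) (dR : R -> R) (t : 'I_l -> R).
Hypothesis hR : is_diff_poly_ring cR dR t.

(** The subset [P] is itself a differential C-algebra containing the t_i, so freeness gives a map
    from R to it; followed by the inclusion this map is the identity, by uniqueness. *)
Lemma diffpoly_ind (P : R -> Prop) :
  (forall c, P (cR c)) -> (forall i, P (t i)) ->
  (forall x y, P x -> P y -> P (x + y)) -> (forall x y, P x -> P y -> P (x * y)) ->
  (forall x, P x -> P (dR x)) -> forall x, P x.
Proof.
move=> PC Pt PD PM Pd.
have [[hd hdc] hU] := hR.
have hP : subring_closed (pred_of_prop P).
  split; first by apply/boolp.asboolP; rewrite -(rmorph1 cR).
    move=> x y /boolp.asboolP hx /boolp.asboolP hy; apply/boolp.asboolP.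
    by apply: PD => //; rewrite -mulN1r -(rmorph1 cR) -rmorphN; apply: PM.
  by move=> x y /boolp.asboolP hx /boolp.asboolP hy; apply/boolp.asboolP; apply: PM.
pose S := prop_subring hP.
have PP x : P x -> x \in closed_pred hP by move=> hx; apply/boolp.asboolP.
have SP (s : S) : P (val s) by apply/boolp.asboolP; apply: (valP s).
pose cS c : S := PropSubring (PP _ (PC c)).
pose dS (s : S) : S := PropSubring (PP _ (Pd _ (SP s))).
have cSD : zmod_morphism cS by move=> x y; apply: val_inj; rewrite /= rmorphB.
have cSM : monoid_morphism cS.
  by split=> [|x y]; apply: val_inj; rewrite /= ?rmorph1 ?rmorphM.
pose cS1 := GRing.isZmodMorphism.Build C S cS cSD.
pose cS2 := GRing.isMonoidMorphism.Build C S cS cSM.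
pose cS' : {rmorphism C -> S} := HB.pack cS cS1 cS2.
have hS : diff_C_alg cS' dS.
  split=> [|c]; last by apply: val_inj; rewrite /= hdc.
  by split=> x y; apply: val_inj; rewrite /= ?(derD (f := id) hd) ?(derM (f := id) hd).
have [[f [[fc fd] ft]] _] := hU S cS' dS hS (fun i => PropSubring (PP _ (Pt i))).
have [_ uniq] := hU R cR dR (conj hd hdc) t.
move=> x; have -> : x = (val \o f) x; last exact: SP.
apply: (uniq idfun (val \o f)) => // [|i] /=; last by rewrite ft.
by split=> y /=; rewrite ?fc ?fd.
Qed.
End DiffPolyInduction.
(** * Partial derivatives of differential polynomials *)

Section PolyDerivation.
Variables (R : comNzRingType) (d : R -> R) (e : R).
Hypothesis hd : isDerivation d.
Implicit Types p q : {poly R}.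

(* The derivation of R[x] extending d with x' = e x. *)
Definition pder p := map_poly d p + e *: ('X * p^`()).

Lemma coef_map_der p i : (map_poly d p)`_i = d p`_i.
Proof. by apply: coef_map_id0; apply: (der0 (f := id) hd). Qed.

Lemma map_poly_der : isDerivation (map_poly d).
Proof.
split=> p q; apply/polyP => i.
  by rewrite coefD !coef_map_der coefD (derD (f := id) hd).
rewrite coefD coef_map_der !coefM (der_sum (f := id) hd) -big_split /=.
by apply: eq_bigr => k _; rewrite (derM (f := id) hd) !coef_map_der.
Qed.

Lemma coef_pder p i : (pder p)`_i = d p`_i + e * p`_i *+ i.
Proof.
rewrite coefD coef_map_der coefZ coefXM coef_deriv; congr (_ + _).
by case: i => [|i] /=; rewrite ?mulr0 ?mulr0n // mulrnAr.
Qed.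

Lemma pder_der : isDerivation pder.
Proof.
split=> p q; rewrite /pder.
  by rewrite (derD (f := id) map_poly_der) derivD mulrDr scalerDr addrACA.
rewrite (derM (f := id) map_poly_der) derivM -!mul_polyC; ring.
Qed.

Lemma pderC c : pder c%:P = (d c)%:P.
Proof.
apply/polyP => i; rewrite coef_pder !coefC.
by case: i => [|i] /=; rewrite ?mulr0n ?addr0 // mulr0 mul0rn (der0 (f := id) hd) addr0.
Qed.

End PolyDerivation.

Section Partials.
Variables (C : fieldType) (l : nat) (R : comNzRingType).
Variables (cR : {rmorphism C -> R}) (dR : R -> R) (t : 'I_l -> R).
Hypothesis hR : is_diff_poly_ring cR dR t.

Let hd : isDerivation dR := hR.1.1.
Let hc c : dR (cR c) = 0 := hR.1.2 c.

(* P x collects the partial derivatives of x with respect to the derivatives t_j^(k)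
   as the coefficients of 'X^k; it is the linear term of t_j |-> t_j + u, where u' = 'X u. *)
Lemma partials_exist j : exists P : R -> {poly R},
  [/\ derivation_along polyC P, forall c, P (cR c) = 0,
      forall i, P (t i) = (i == j)%:R
    & forall x, P (dR x) = map_poly dR (P x) + 'X * P x].
Proof.
(* [ds] makes the inner 'X constant, and [D] gives the outer variable u the derivative 'X u. Thus
   the k-th derivative of u is 'X^k u, and the exponent of 'X records the order. *)
pose ds := pder dR 0; have hds : isDerivation ds := pder_der 0 hd.
pose D := pder ds 'X; have hD : isDerivation D := pder_der 'X hds.
pose cS : {rmorphism C -> {poly {poly R}}} := polyC \o polyC \o cR.
have hS : diff_C_alg cS D by split=> // c; rewrite /D /ds /= !pderC // ?hc ?polyC0.
have [[f [[fc fd] ft]] _] := hR.2 _ cS D hS (fun i => (t i)%:P%:P + (i == j)%:R *: 'X).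
have hS1 : diff_C_alg (polyC \o cR : {rmorphism C -> {poly R}}) ds.
  by split=> // c; rewrite /ds /= pderC // hc polyC0.
have f0 x : (f x)`_0 = x%:P.
  have [_ uniq] := hR.2 _ _ ds hS1 (fun i => (t i)%:P).
  pose g : {rmorphism R -> {poly R}} := horner_eval 0 \o f.
  rewrite -horner_coef0; apply: (uniq g (polyC : {rmorphism R -> {poly R}})) => //.
  - split=> [c|y]; rewrite /g /= /horner_eval horner_coef0 ?fc /= ?coefC //.
    by rewrite fd coef_pder // mulr0n addr0 horner_coef0.
  - by move=> i; rewrite /g /= /horner_eval horner_coef0 ft coefD coefZ coefX coefC mulr0 addr0.
  - by split=> [c|y] //=; rewrite /ds pderC.
exists (fun x => (f x)`_1); split=> [|c|i|x].
- split=> x y; first by rewrite rmorphD coefD.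
  by rewrite rmorphM coefM !big_ord_recl big_ord0 /= !f0 addr0 addrC mulrC.
- by rewrite fc /= coefC.
- by rewrite ft coefD coefZ coefX coefC add0r mulr1.
- rewrite fd coef_pder // mulr1n /ds /pder scale0r addr0; congr (_ + _).
Qed.

Definition partials j : R -> {poly R} :=
  proj1_sig (constructive_indefinite_description _ (partials_exist j)).
Definition partial j k (x : R) : R := (partials j x)`_k.

Lemma partialsP j :
  [/\ derivation_along polyC (partials j), forall c, partials j (cR c) = 0,
      forall i, partials j (t i) = (i == j)%:R
    & forall x, partials j (dR x) = map_poly dR (partials j x) + 'X * partials j x].
Proof. exact: (proj2_sig (constructive_indefinite_description _ (partials_exist j))). Qed.

Lemma partial_der j k : isDerivation (partial j k).
Proof.
have [hP _ _ _] := partialsP j; rewrite /partial.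
split=> x y; first by rewrite (derD hP) coefD.
by rewrite (derM hP) coefD coefMC coefCM.
Qed.

Lemma partial_const j k c : partial j k (cR c) = 0.
Proof. by have [_ h _ _] := partialsP j; rewrite /partial h coef0. Qed.

Lemma partial_gen j k i : partial j k (t i) = ((i == j) && (k == 0%N))%:R.
Proof.
have [_ _ h _] := partialsP j; rewrite /partial h.
by case: eqP => _ //=; rewrite ?coef0 // coef1.
Qed.

Lemma partial_d j k x : partial j k.+1 (dR x) = dR (partial j k.+1 x) + partial j k x.
Proof.
by have [_ _ _ h] := partialsP j; rewrite /partial h coefD coef_map_der // coefXM.
Qed.

Lemma partial_d0 j x : partial j 0 (dR x) = dR (partial j 0 x).
Proof.
by have [_ _ _ h] := partialsP j; rewrite /partial h coefD coef_map_der // coefXM addr0.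
Qed.

Lemma partial_fin x : exists K, forall j k, (K <= k)%N -> partial j k x = 0.
Proof.
exists (\max_j size (partials j x)) => j k hk; apply: nth_default.
by apply: leq_trans hk; apply: leq_bigmax.
Qed.

(** In characteristic zero this says that x has degree less than n in the t_j^(k). It is phrased
    through derivations because R is known only by its universal property. *)
Fixpoint pfilt n (x : R) : Prop :=
  if n is m.+1 then forall j k, pfilt m (partial j k x) else x = 0.

Lemma pfilt0 n : pfilt n 0.
Proof.
by elim: n => //= n IH j k; rewrite (der0 (f := id) (partial_der j k)).
Qed.

Lemma pfiltS n x : pfilt n x -> pfilt n.+1 x.
Proof.
elim: n x => [x -> |n IH x h j k]; last exact/IH/h.
exact: pfilt0.
Qed.

Lemma pfiltW m n x : (m <= n)%N -> pfilt m x -> pfilt n x.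
Proof. by move/subnK <-; elim: (n - m)%N => //= k IH /IH/pfiltS. Qed.

Lemma pfiltD n x y : pfilt n x -> pfilt n y -> pfilt n (x + y).
Proof.
elim: n x y => [x y -> ->|n IH x y hx hy j k]; first by rewrite /= addr0.
by rewrite (derD (f := id) (partial_der j k)); apply: IH.
Qed.

Lemma pfiltM m n x y : pfilt m x -> pfilt n y -> pfilt (m + n) (x * y).
Proof.
elim: m n x y => [n x y -> _|m IH]; first by rewrite mul0r; apply: pfilt0.
elim=> [x y _ ->|n IHn x y hx hy]; first by rewrite mulr0; apply: pfilt0.
suff h j k : pfilt (m + n.+1) (partial j k (x * y)) by [].
rewrite (derM (f := id) (partial_der j k)); apply: pfiltD; first exact: IH.
by rewrite -addSnnS; apply: IHn.
Qed.

Lemma pfilt_d n x : pfilt n x -> pfilt n (dR x).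
Proof.
elim: n x => [x ->|n IH x hx j [|k]]; first by rewrite /= (der0 (f := id) hd).
  by rewrite partial_d0; apply/IH/hx.
by rewrite partial_d; apply: pfiltD; [apply/IH/hx | apply: hx].
Qed.

Lemma pfiltP x : exists n, pfilt n x.
Proof.
elim/(diffpoly_ind hR): x => [c|i|x y [m hx] [n hy]|x y [m hx] [n hy]|x [n hx]].
- by exists 1%N => j k; rewrite partial_const.
- exists 2%N => j k j' k' /=; rewrite partial_gen; case: (_ && _).
    by rewrite -(rmorph1 cR) partial_const.
  by rewrite (der0 (f := id) (partial_der j' k')).
- exists (maxn m n); apply: pfiltD.
    by apply: pfiltW hx; apply: leq_maxl.
  by apply: pfiltW hy; apply: leq_maxr.
- by exists (m + n)%N; apply: pfiltM.
- by exists n; apply: pfilt_d.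
Qed.

(* Euler's identity: scaling every t_j by u, the derivative in u is
   the sum of the partial derivatives times the t_j^(k). *)
Lemma partials_kernel : [pchar C] =i pred0 ->
  forall x, (forall j k, partial j k x = 0) -> exists c, x = cR c.
Proof.
move=> hchar.
pose D := pder dR 0; have hD : isDerivation D := pder_der 0 hd.
have DE p : D p = map_poly dR p by rewrite /D /pder scale0r addr0.
have hS : diff_C_alg (polyC \o cR : {rmorphism C -> {poly R}}) D.
  by split=> // c; rewrite /D /= pderC // hc polyC0.
have [[f [[fc fd] ft]] _] := hR.2 _ _ D hS (fun i => (t i) *: 'X).
have hmap p : (map_poly dR p).[1] = dR p.[1].
  have le : (size (map_poly dR p) <= size p)%N by apply: size_poly.
  rewrite (horner_coef_wide _ le) horner_coef (der_sum (f := id) hd).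
  by apply: eq_bigr => i _; rewrite !expr1n !mulr1 coef_map_der.
have f1 x : (f x).[1] = x.
  have [_ uniq] := hR.2 _ _ dR hR.1 t.
  apply: (uniq (horner_eval 1 \o f : {rmorphism R -> R}) idfun) => //= [|i].
    by split=> [c|y]; rewrite /= /horner_eval ?fc /= ?hornerC // fd DE hmap.
  by rewrite /horner_eval ft !hornerE.
(* The constant term in the scaling variable is the value at t = 0. *)
have f0 x : exists c, (f x)`_0 = cR c.
  elim/(diffpoly_ind hR): x => [c|i|x y [m hx] [n hy]|x y [m hx] [n hy]|x [n hx]].
  - by exists c; rewrite fc /= coefC.
  - by exists 0; rewrite ft coefZ coefX mulr0 rmorph0.
  - by exists (m + n); rewrite (rmorphD f) coefD hx hy rmorphD.
  - by exists (m * n); rewrite (rmorphM f) coefM big_ord1 hx hy rmorphM.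
  - by exists 0; rewrite fd DE coef_map_der // hx hc rmorph0.
(* [h j] applies [f] to coefficients and sends 'X^k to t_j^(k), so [h j (partials j x)] is the j-th
   part of Euler's sum. *)
pose h j (p : {poly R}) := \sum_(k < size p) f p`_k * (iter k dR (t j))%:P.
have hE j (p : {poly R}) N : (size p <= N)%N -> h j p = \sum_(k < N) f p`_k * (iter k dR (t j))%:P.
  move=> le; rewrite /h (big_ord_widen _ (fun k => f p`_k * (iter k dR (t j))%:P) le).
  rewrite big_mkcond /=; apply: eq_bigr => k _; case: ltnP => // hk.
  by rewrite nth_default // rmorph0 mul0r.
have hDD j (p q : {poly R}) : h j (p + q) = h j p + h j q.
  pose N := maxn (size p) (size q).
  rewrite (hE _ (p + q) N) ?(hE _ p N) ?(hE _ q N) ?leq_maxl ?leq_maxr //; last first.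
    exact: size_polyD.
  by rewrite -big_split; apply: eq_bigr => k _; rewrite coefD rmorphD mulrDl.
have hZ j a (p : {poly R}) : h j (a%:P * p) = f a * h j p.
  rewrite (hE _ _ (size p)) ?mul_polyC ?size_scale_leq // mulr_sumr.
  by apply: eq_bigr => k _; rewrite coefZ rmorphM mulrA.
have hd' j (p : {poly R}) : h j (map_poly dR p + 'X * p) = D (h j p).
  rewrite (hE _ _ (size p).+1) ?(hE _ p (size p).+1) //; last first.
    rewrite (leq_trans (size_polyD _ _)) // geq_max (leq_trans (size_poly _ _)) //=.
    have [->|p0] := eqVneq p 0; first by rewrite mulr0 size_poly0.
    by rewrite mulrC size_mulX.
  rewrite (der_sum (f := id) hD).
  under eq_bigr => k _ do rewrite coefD coef_map_der // rmorphD mulrDl fd.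
  under [RHS]eq_bigr => k _ do rewrite (derM (f := id) hD) [D (_)%:P]pderC //.
  rewrite !big_split; congr (_ + _) => /=.
  rewrite big_ord_recl coefXM rmorph0 mul0r add0r [RHS]big_ord_recr /=.
  rewrite [p`_(size p)]nth_default // rmorph0 mul0r addr0.
  by apply: eq_bigr => k _; rewrite coefXM.
have euler x : (f x)^`() = \sum_j h j (partials j x).
  elim/(diffpoly_ind hR): x => [c|i|x y hx hy|x y hx hy|x hx].
  - rewrite fc /= derivC big1 // => j _.
    by have [_ -> _ _] := partialsP j; rewrite /h size_poly0 big_ord0.
  - rewrite ft derivZ derivX (bigD1 i) //= big1 => [|j /negbTE ji].
      have [_ _ -> _] := partialsP i.
      by rewrite eqxx /h size_poly1 big_ord1 coef1 rmorph1 mul1r addr0 alg_polyC.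
    have [_ _ -> _] := partialsP j.
    by rewrite eq_sym ji /h size_poly0 big_ord0.
  - rewrite rmorphD derivD hx hy -big_split; apply: eq_bigr => j _.
    by have [hP _ _ _] := partialsP j; rewrite (derD hP) hDD.
  - rewrite rmorphM derivM hx hy mulr_suml mulr_sumr -big_split; apply: eq_bigr => j _ /=.
    by have [hP _ _ _] := partialsP j; rewrite (derM hP) hDD (mulrC (partials j x)) !hZ (mulrC (f y)).
  - rewrite fd; transitivity (D (f x)^`()).
      apply/polyP => i; rewrite !DE coef_deriv !coef_map_der // coef_deriv.
      by rewrite (derMn (f := id) hd).
    rewrite hx (der_sum (f := id) hD); apply: eq_bigr => j _.
    by have [_ _ _ ->] := partialsP j; rewrite hd'.
move=> x hx; have fx' : (f x)^`() = 0.
  rewrite euler big1 // => j _; rewrite (_ : partials j x = 0); last first.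
    by apply/polyP => k; rewrite coef0; apply: hx.
  by rewrite /h size_poly0 big_ord0.
(* In characteristic zero [f x] is now constant in u: its value at 1 is x, and its value at 0 comes
   from C. *)
have [c hc0] := f0 x; exists c; rewrite -(f1 x) -hc0.
suff -> : f x = ((f x)`_0)%:P by rewrite hornerC coefC.
apply/polyP => -[|i]; rewrite coefC //=.
have /(congr1 (fun p : {poly R} => p`_i)) := fx'; rewrite coef_deriv coef0 => hi.
have ci : i.+1%:R != 0 :> C by rewrite pcharf0P in hchar *; rewrite ?hchar.
have : cR (i.+1%:R^-1) * ((f x)`_i.+1 *+ i.+1) = 0 by rewrite hi mulr0.
by rewrite -[(f x)`_i.+1 *+ _]mulr_natl mulrA -(rmorph_nat cR) -rmorphM mulVf // rmorph1 mul1r.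
Qed.

(** Replacing a nonzero element by a nonzero partial derivative lowers its [pfilt] order; the
    process stops at a nonzero constant, which is a unit. *)
Lemma partials_simple (J : R -> Prop) : [pchar C] =i pred0 -> is_ideal J ->
  (forall j k x, J x -> J (partial j k x)) -> (exists2 x, x != 0 & J x) -> J 1.
Proof.
move=> hchar hJ hst [x x0 Jx]; have [n hn] := pfiltP x.
elim: n x x0 Jx hn => [x /eqP x0 _ //|n IH x x0 Jx hx].
have [[j [k hjk]]|h] := classic (exists j k, partial j k x != 0).
  by apply: (IH (partial j k x)) => //; apply: hst.
have [j k|c xc] := partials_kernel hchar (x := x).
  by apply/eqP; apply: contra_notT h => ?; exists j, k.
have c0 : c != 0 by apply: contraNneq x0 => c0; rewrite xc c0 rmorph0.
case: hJ => _ _ /(_ (cR c^-1) _ Jx).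
by rewrite xc -rmorphM mulVf // rmorph1.
Qed.
End Partials.
(** * The Nullstellensatz *)

Section PrimeIdeals.
Variable R : comNzRingType.

Definition is_prime (P : R -> Prop) :=
  [/\ is_ideal P, ~ P 1 & forall a b, P (a * b) -> P a \/ P b].

Lemma is_primeX P a m : is_prime P -> P (a ^+ m) -> P a.
Proof.
case=> hI h1 hP; elim: m => [|m IH]; first by rewrite expr0 => /h1.
by rewrite exprS => /hP [].
Qed.

(** By Zorn's lemma there is an ideal maximal among those containing I and missing every power of g,
    and such an ideal is prime. *)
Lemma prime_avoiding (I : R -> Prop) g : is_ideal I -> (forall m, ~ I (g ^+ m)) ->
  exists P, [/\ is_prime P, forall x, I x -> P x & ~ P g].
Proof.
move=> hI hg.
pose T := {J : R -> Prop | [/\ is_ideal J, forall x, I x -> J x & forall m, ~ J (g ^+ m)]}.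
pose J0 : T := exist _ I (And3 hI (fun x h => h) hg).
have [] := @classical_sets.Zorn T
    (fun J K => boolp.asbool (forall x, sval J x -> sval K x)).
- by move=> J; apply/boolp.asboolP.
- move=> J K L /boolp.asboolP h1 /boolp.asboolP h2.
  by apply/boolp.asboolP => x /h1/h2.
- move=> [J hJ] [K hK] /boolp.asboolP h1 /boolp.asboolP h2; apply: boolp.eq_exist => /=.
  by apply/boolp.funext => x; apply/boolp.propext; split; [apply: h1 | apply: h2].
- move=> A tot.
  have [[J1 AJ1]|h] := classic (exists J, A J); last first.
    by exists J0 => s As; case: h; exists s.
  pose U x := exists2 J : T, A J & sval J x.
  suff hU : [/\ is_ideal U, forall x, I x -> U x & forall m, ~ U (g ^+ m)].
    by exists (exist _ U hU) => s As; apply/boolp.asboolP => x hx; exists s.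
  split=> [|x hx|m [J _]].
  + split=> [|x y [J AJ Jx] [K AK Ky]|a x [J AJ Jx]].
    * by exists J1 => //; case: (svalP J1) => -[].
    * case: (tot J K AJ AK) => /boolp.asboolP h.
        exists K => //; case: (svalP K) => -[_ hD _] _ _; apply: hD => //; exact: h.
      exists J => //; case: (svalP J) => -[_ hD _] _ _; apply: hD => //; exact: h.
    * by exists J => //; case: (svalP J) => -[_ _ hM] _ _; apply: hM.
  + by exists J1 => //; case: (svalP J1) => _ h _; apply: h.
  + by case: (svalP J) => _ _ h /h.
move=> [P hPP] hmax; exists P; have [hP IP Pg] := hPP.
have [P0 PD PM] := hP.
split=> //; last by rewrite -[g]expr1; apply: Pg.
split=> //; first by rewrite -(expr0 g); apply: Pg.
(* If a is outside P, maximality puts a power of g into P + (a). *)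
have key a : ~ P a -> exists m u p, P p /\ g ^+ m = u * a + p.
  move=> Pa; apply: boolp.contrapT => hno.
  pose Q x := exists u p, P p /\ x = u * a + p.
  have hQ : [/\ is_ideal Q, forall x, I x -> Q x & forall m, ~ Q (g ^+ m)].
    split=> [|x hx|m [u [p [Pp e]]]].
    - split=> [|x y [u [p [Pp ->]]] [v [q [Pq ->]]]|b x [u [p [Pp ->]]]].
      + by exists 0, 0; rewrite mul0r addr0.
      + by exists (u + v), (p + q); split; [apply: PD | rewrite mulrDl addrACA].
      + by exists (b * u), (b * p); split; [apply: PM | rewrite mulrDr mulrA].
    - by exists 0, x; split; [apply: IP | rewrite mul0r add0r].
    - by apply: hno; exists m, u, p.
  have /(congr1 sval) /= e : (exist _ Q hQ : T) = exist _ P hPP.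
    by apply: hmax; apply/boolp.asboolP => x /= Px; exists 0, x; rewrite mul0r add0r.
  by apply: Pa; rewrite -e; exists 1, 0; rewrite mul1r addr0.
move=> a b Pab; apply: boolp.contrapT => h.
have [m [u [p [Pp e1]]]] : exists m u p, P p /\ g ^+ m = u * a + p.
  by apply: key => Pa; apply: h; left.
have [k [v [q [Pq e2]]]] : exists m u p, P p /\ g ^+ m = u * b + p.
  by apply: key => Pb; apply: h; right.
apply: (Pg (m + k)%N); rewrite exprD e1 e2 mulrDl; apply: (PD); last first.
  by rewrite mulrC; apply: PM.
rewrite mulrDr; apply: PD; last exact: PM.
by rewrite mulrACA; apply: PM.
Qed.
End PrimeIdeals.

Lemma prime_preimage (R S : comNzRingType) (h : {rmorphism R -> S}) (P : S -> Prop) :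
  is_prime P -> is_prime (fun x => P (h x)).
Proof.
case=> -[P0 PD PM] P1 PP; split=> [||a b]; last by rewrite rmorphM; apply: PP.
- split=> [|x y|a x]; first by rewrite rmorph0.
  + by rewrite rmorphD; apply: PD.
  + by rewrite rmorphM; apply: PM.
- by rewrite rmorph1.
Qed.

Section PrimeExtension.
Variables (C : closedFieldType) (A : idomainType) (P : {poly A} -> Prop) (b : {poly A}).
Hypotheses (hP : is_prime P) (Pb : ~ P b).

Let p (a : A) := P a%:P.
Let coefs_in (f : {poly A}) := forall i, p f`_i.

Let PI : is_ideal P. Proof. by case: hP. Qed.
Let P0 : P 0. Proof. by case: PI. Qed.
Let PD x y : P x -> P y -> P (x + y). Proof. by case: PI => _ h _; apply: h. Qed.
Let PM a x : P x -> P (a * x). Proof. by case: PI => _ _ h; apply: h. Qed.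

Let coefs_inP f : coefs_in f -> P f.
Proof.
move=> hf; rewrite -[f]coefK poly_def; apply: (ideal_sum _ PI) => i _.
by rewrite -mul_polyC mulrC; apply/PM/hf.
Qed.

Let pM a x : p x -> p (a * x). Proof. by rewrite /p polyCM; apply: PM. Qed.
Let pX a m : p (a ^+ m) -> p a. Proof. by rewrite /p rmorphXn; apply: is_primeX. Qed.
Let p_prime a x : p (a * x) -> p a \/ p x.
Proof. by rewrite /p polyCM; case: hP => _ _; apply. Qed.
Let coefs_inM u f : coefs_in f -> coefs_in (u * f).
Proof.
move=> hf i; rewrite coefM /p raddf_sum; apply: (ideal_sum _ PI) => k _.
by rewrite /= polyCM; apply/PM/hf.
Qed.
Let coefs_inD f g : coefs_in f -> coefs_in g -> coefs_in (f + g).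
Proof. by move=> hf hg i; rewrite coefD /p polyCD; apply: PD; [apply: hf | apply: hg]. Qed.

(** Minimal size forces the leading coefficient out of [p]: otherwise dropping the leading term
    would leave a smaller element with a coefficient outside [p]. *)
Let minimal_elt (J : {poly A} -> Prop) : is_ideal J -> (forall f, coefs_in f -> J f) ->
  (exists2 f, J f & ~ coefs_in f) ->
  exists f, [/\ J f, ~ p (lead_coef f) &
    forall g, J g -> (size g < size f)%N -> coefs_in g].
Proof.
move=> hJ pJ [f0 Jf0 hf0].
have [|f [Jf hf] fmin] := @minimizer_exists _ (fun f : {poly A} => size f)
  (fun f => J f /\ ~ coefs_in f); first by exists f0.
have hmin g : J g -> (size g < size f)%N -> coefs_in g.
  move=> Jg lt; apply: boolp.contrapT => hg.
  by move: lt; rewrite ltnNge fmin.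
exists f; split=> // plf; apply: (hf).
have nzf : f != 0 by apply: contra_not_neq hf => -> i; rewrite coef0.
have hl : coefs_in (lead_coef f *: 'X^((size f).-1)).
  by move=> i; rewrite coefZ mulrC; apply: pM.
rewrite -[f](subrK (lead_coef f *: 'X^((size f).-1))); apply: coefs_inD => //.
apply: hmin; first by apply: idealB => //; apply: pJ.
rewrite -[X in (_ < X)%N](prednK (n := size f)) ?size_poly_gt0 // ltnS; apply/leq_sizeP => i hi.
rewrite coefB coefZ coefXn; move: hi; rewrite leq_eqVlt => /orP[/eqP <-|hi].
  by rewrite eqxx mulr1 subrr.
rewrite gtn_eqF // mulr0 subr0 nth_default //.
by rewrite -(prednK (n := size f)) ?size_poly_gt0.
Qed.

(** Extension of a point along one variable. Over the fraction field of A/p, either P is zero or it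
    is generated by one polynomial modulo which b is invertible; [a] collects the coefficients that
    must stay nonzero for this to specialize. *)
Lemma prime_extension : exists a, ~ P a%:P /\
  forall phi : {rmorphism A -> C}, (forall x, P x%:P -> phi x = 0) -> phi a != 0 ->
  exists y, (forall f, P f -> (map_poly phi f).[y] = 0) /\ (map_poly phi b).[y] != 0.
Proof.
have coefs0 (phi : {rmorphism A -> C}) f : (forall x, P x%:P -> phi x = 0) ->
    coefs_in f -> map_poly phi f = 0.
  by move=> hphi hf; apply/polyP => i; rewrite coef_map coef0; apply/hphi/hf.
(* In the first case P comes from A: a coefficient of [b] outside [p] keeps the specialized [b]
   nonzero, and any nonroot serves as y. *)
have [hPp|hPp] := classic (forall f, P f -> coefs_in f).
  have [i hi] : exists i, ~ p b`_i.
    by apply: boolp.contrapT => h; apply: Pb; apply: coefs_inP => i;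
      apply: boolp.contrapT => hi; apply: h; exists i.
  exists b`_i; split=> // phi hphi bi0.
  have hb : map_poly phi b != 0.
    by apply: contraNneq bi0 => /polyP/(_ i); rewrite coef_map coef0 => ->.
  have [y hy] := closed_nonrootP _ hb.
  by exists y; split=> [f /hPp/(coefs0 _ _ hphi) ->|//]; rewrite horner0.
have hPex : exists2 f, P f & ~ coefs_in f.
  by apply: boolp.contrapT => h; apply: hPp => f Pf; apply: boolp.contrapT => hf; apply: h; exists f.
have [p0 [Pp0 lp0 min0]] := minimal_elt PI coefs_inP hPex.
pose J f := exists u q, P q /\ f = u * b + q.
have PJ f : P f -> J f by move=> Pf; exists 0, f; rewrite mul0r add0r.
have hJ : is_ideal J.
  split=> [|x y [u [p1 [Pp1 ->]]] [v [q [Pq ->]]]|c x [u [q [Pq ->]]]].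
  + exact: PJ.
  + by exists (u + v), (p1 + q); split; [apply: PD | rewrite mulrDl addrACA].
  + by exists (c * u), (c * q); split; [apply: PM | rewrite mulrDr mulrA].
have Jb : J b by exists 1, 0; rewrite mul1r addr0.
have [||r [Jr lr minr]] := minimal_elt hJ.
- by move=> f /coefs_inP/PJ.
- by case: hPex => f Pf hf; exists f => //; apply: PJ.
have r0 : r != 0 by apply: contra_not_neq lr => ->; rewrite lead_coef0.
have p00 : p0 != 0 by apply: contra_not_neq lp0 => ->; rewrite lead_coef0.
have p1 x m : p (lead_coef x ^+ m) -> p (lead_coef x) by apply: pX.
(* Pseudo-division: the remainder is smaller than [g], so by minimality its coefficients lie in
   [p]. *)
have div (K : {poly A} -> Prop) (f g : {poly A}) : is_ideal K ->
    (forall h, K h -> (size h < size g)%N -> coefs_in h) -> K f -> K g -> g != 0 ->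
    P (lead_coef g ^+ scalp f g *: f - f %/ g * g).
  move=> hK hmin Kf Kg g0; apply: coefs_inP; apply: hmin.
    by apply: idealB => //; case: hK => _ _ hM; rewrite -?mul_polyC; apply: hM.
  by rewrite Pdiv.Idomain.divp_eq addrC addKr Pdiv.Idomain.ltn_modp.
have scalP c f : P (c *: f) -> p c \/ P f by rewrite -mul_polyC; case: hP => _ _ /(_ c%:P f).
have Pr : ~ P r.
  move=> Pr; have := div J _ _ hJ minr Jb Jr r0 => h.
  have : P (lead_coef r ^+ scalp b r *: b).
    by rewrite -[_ *: b](subrK (b %/ r * r)); apply: PD => //; apply: PM.
  by case/scalP => // /p1.
(* If [r] had positive degree, it would divide [p0] modulo p up to a power of its leading
   coefficient. By primality the quotient lies in P; being smaller than [p0] it vanishes modulo p,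
   and then so does the leading coefficient of [p0]. *)
have r1 : size r = 1%N.
  have [le|lt] := leqP (size r) 1; first by apply/eqP; rewrite eqn_leq le size_poly_gt0.
  exfalso.
  have hs := div J _ _ hJ minr (PJ _ Pp0) Jr r0.
  have Pq : P (p0 %/ r).
    have : P (p0 %/ r * r).
      rewrite -[p0 %/ r * r](subKr (lead_coef r ^+ scalp p0 r *: p0)); apply: idealB => //.
      by rewrite -mul_polyC; apply: PM.
    by case: hP => _ _ h /h [].
  have hq : coefs_in (p0 %/ r).
    apply: min0 => //; rewrite Pdiv.Idomain.size_divp // ltn_subrL size_poly_gt0 p00 andbT.
    by case: (size r) lt => [|[|k]].
  have hp0 : coefs_in (lead_coef r ^+ scalp p0 r *: p0).
    rewrite Pdiv.Idomain.divp_eq; apply: coefs_inD; first by rewrite mulrC; apply: coefs_inM.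
    apply: minr; last by rewrite Pdiv.Idomain.ltn_modp.
    by apply: PJ; move: hs; rewrite Pdiv.Idomain.divp_eq addrC addKr.
  have := hp0 (size p0).-1; rewrite coefZ => /p_prime [/p1|] //.
have [u [q [Pq er]]] := Jr.
have rE : r = (lead_coef r)%:P by rewrite {1}(size1_polyC (eq_leq r1)) lead_coefE r1.
(* The first factor keeps [p0] nonconstant under [phi], which provides a root; the second keeps the
   constant [r] = u b + q nonzero, so [b] cannot vanish at that root. *)
exists (lead_coef p0 * lead_coef r); split=> [/p_prime [] //|phi hphi].
rewrite rmorphM mulf_eq0 negb_or => /andP[n1 n2].
have [y hy] : exists y, root (map_poly phi p0) y.
  apply/closed_rootP; rewrite size_map_poly_id0 //; apply: contra_not_neq lp0 => sp0.
  by move: Pp0; rewrite (size1_polyC (eq_leq sp0)) lead_coefC.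
have hall (f : {poly A}) : P f -> (map_poly phi f).[y] = 0.
  move=> Pf; have hs := div P _ _ PI min0 Pf Pp0 p00.
  have /(coefs0 _ _ hphi) : coefs_in (f %% p0).
    apply: min0; last by rewrite Pdiv.Idomain.ltn_modp.
    by move: hs; rewrite Pdiv.Idomain.divp_eq addrC addKr.
  move=> h0; have e : map_poly phi (lead_coef p0 ^+ scalp f p0 *: f) =
      map_poly phi (f %/ p0) * map_poly phi p0.
    by rewrite Pdiv.Idomain.divp_eq rmorphD rmorphM /= h0 addr0.
  move: e; rewrite map_polyZ => /(congr1 (horner^~ y)) /eqP.
  rewrite hornerM (eqP hy) mulr0 hornerZ mulf_eq0 rmorphXn expf_eq0 (negbTE n1) andbF.
  by move/eqP.
exists y; split=> //.
apply: contraNneq n2 => hb.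
have /(congr1 (fun f => (map_poly phi f).[y])) := er.
rewrite rmorphD rmorphM hornerD hornerM hb mulr0 add0r (hall _ Pq) {1}rE map_polyC hornerC.
by move->.
Qed.
End PrimeExtension.

Section Nullstellensatz.
Variable C : closedFieldType.

(** Induction on the number of variables. [tau] splits off the last one, and the element [a] of
    [prime_extension] plays the role of b for the remaining ones. *)
Lemma prime_point n (P : {mpoly C[n]} -> Prop) (b : {mpoly C[n]}) :
  is_prime P -> ~ P b -> exists c : 'I_n -> C, (forall f, P f -> f.@[c] = 0) /\ b.@[c] != 0.
Proof.
elim: n P b => [|n IH] P b hP Pb.
  have cst (f : {mpoly C[0]}) : f = (f@_0)%:MP.
    apply/mpolyP => m; rewrite mcoeffC (_ : m = 0%MM) ?eqxx ?mulr1 //.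
    by apply/mnmP => -[].
  have [[P0 _ PM] P1 _] := hP.
  have ev (f : {mpoly C[0]}) c : f.@[c] = f@_0 by rewrite {1}(cst f) mevalC.
  exists (fun _ => 0); split=> [f Pf|]; rewrite ev.
    apply/eqP; apply: boolp.contrapT => /negP f0; apply: P1.
    by have := PM (f@_0)^-1%:MP _ Pf; rewrite {2}(cst f) -mpolyCM mulVf.
  by apply: contra_not_neq Pb => b0; rewrite (cst b) b0 mpolyC0.
pose wid : {rmorphism {mpoly C[n]} -> {mpoly C[n.+1]}} :=
  mmap (@mpolyC n.+1 C) (fun j => 'X_(lift ord_max j)).
pose rho : {rmorphism {poly {mpoly C[n]}} -> {mpoly C[n.+1]}} :=
  horner_eval 'X_ord_max \o map_poly wid.
pose h (i : 'I_n.+1) : {poly {mpoly C[n]}} :=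
  if unlift ord_max i is Some j then ('X_j)%:P else 'X.
pose tau : {rmorphism {mpoly C[n.+1]} -> {poly {mpoly C[n]}}} :=
  mmap (polyC \o @mpolyC n C) h.
have tauK p : rho (tau p) = p.
  apply: (mpoly_rmorph_ext (f := rho \o tau) (g := idfun)) p => [c|i] /=.
    by rewrite /tau /rho /= mmapC /horner_eval map_polyC hornerC /= /wid /= mmapC.
  rewrite /tau /rho /= mmapX mmap1U /horner_eval /h; case: unliftP => [j ->|->].
    by rewrite map_polyC hornerC /= /wid /= mmapX mmap1U.
  by rewrite map_polyX hornerX.
pose Q f := P (rho f).
have hQ : is_prime Q := prime_preimage rho hP.
have Qb : ~ Q (tau b) by rewrite /Q tauK.
have [a [Pa ha]] := @prime_extension C _ Q _ hQ Qb.
have hQ' : is_prime (fun x => Q x%:P) := prime_preimage (@polyC _) hQ.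
have [c [hc1 hc2]] := IH _ _ hQ' Pa.
have [y [hy1 hy2]] := ha (meval c) hc1 hc2.
pose c' i := if unlift ord_max i is Some j then c j else y.
have ev p : p.@[c'] = (map_poly (meval c) (tau p)).[y].
  apply: (mpoly_rmorph_ext (f := meval c')
    (g := horner_eval y \o map_poly (meval c) \o tau)) p => [x|i] /=.
    by rewrite mevalC /horner_eval /tau /= mmapC map_polyC hornerC /= mevalC.
  rewrite mevalXU /tau /= mmapX mmap1U /horner_eval /h /c'; case: unliftP => [j _|_].
    by rewrite map_polyC hornerC /= mevalXU.
  by rewrite map_polyX hornerX.
exists c'; split=> [f Pf|]; last by rewrite ev.
by rewrite ev; apply: hy1; rewrite /Q tauK.
Qed.

Lemma nullstellensatz n (I : {mpoly C[n]} -> Prop) (b : {mpoly C[n]}) :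
  is_ideal I -> (forall m, ~ I (b ^+ m)) ->
  exists c : 'I_n -> C, (forall f, I f -> f.@[c] = 0) /\ b.@[c] != 0.
Proof.
move=> hI hb; have [P [hP IP Pb]] := prime_avoiding hI hb.
have [c [hc hbc]] := prime_point hP Pb.
by exists c; split=> // f /IP/hc.
Qed.
End Nullstellensatz.
(** * Constant descent and linear algebra over a domain *)

Lemma size_msupp_lt (R : nzRingType) N (v w : {mpoly R[N]}) m :
  {subset msupp w <= msupp v} -> m \in msupp v -> m \notin msupp w ->
  (size (msupp w) < size (msupp v))%N.
Proof.
move=> sub mv mw; rewrite -[(size _).+1]/(size (m :: msupp w)).
apply: uniq_leq_size; first by rewrite /= mw msupp_uniq.
by move=> k; rewrite inE => /orP[/eqP ->|/sub].
Qed.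

(* A subspace stable under the coefficientwise derivation is spanned by its elements with constant coefficients. *)
Lemma constant_descent (E : fieldType) (dE : E -> E) N (V S : {mpoly E[N]} -> Prop) :
  isDerivation dE ->
  (forall v w, V v -> V w -> V (v + w)) -> (forall c v, V v -> V (c *: v)) ->
  (forall v, V v -> V (dcoef dE v)) ->
  S 0 -> (forall v w, S v -> S w -> S (v + w)) -> (forall c v, S v -> S (c *: v)) ->
  (forall v, V v -> (forall m, dE v@_m = 0) -> S v) -> forall v, V v -> S v.
Proof.
move=> hd VD VZ Vd S0 SD SZ hS v Vv.
have [n le] := ubnP (size (msupp v)); elim: n v le Vv => // n IH v le Vv.
have [->|v0] := eqVneq v 0; first exact: S0.
(* Take u of minimal support, scaled to have a coefficient 1: its derivative has smaller support,
   hence is zero, so the coefficients are constants. Subtracting a multiple of it then shrinks the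
   support of v. *)
have [|u [Vu u0 uv] umin] := @minimizer_exists _ (fun u => size (msupp u))
  (fun u => [/\ V u, u != 0 & {subset msupp u <= msupp v}]).
  by exists v; split.
have [m mu] : exists m, m \in msupp u.
  by exists (mlead u); apply: mlead_supp.
have um0 : u@_m != 0 by rewrite -mcoeff_msupp.
pose u1 := (u@_m)^-1 *: u.
have supp1 (w : {mpoly E[N]}) k : (k \in msupp w) = (w@_k != 0) by exact: mcoeff_msupp.
have Vu1 : V u1 by apply: VZ.
have u1m : u1@_m = 1 by rewrite mcoeffZ mulVf.
have Su1 : S u1.
  apply: hS => // k; rewrite -mcoeff_dcoef //.
  suff -> : dcoef dE u1 = 0 by rewrite mcoeff0.
  have sub : {subset msupp (dcoef dE u1) <= msupp u}.
    move=> j; rewrite !supp1; apply: contraNneq => uj.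
    by rewrite mcoeff_dcoef // mcoeffZ uj mulr0 (der0 (f := id) hd).
  apply/eqP; apply: boolp.contrapT => /negP d0.
  suff : (size (msupp (dcoef dE u1)) < size (msupp u))%N.
    by rewrite ltnNge umin //; split=> [||k' /sub/uv //]; first exact: Vd.
  apply: size_msupp_lt sub mu _; rewrite supp1 negbK mcoeff_dcoef // u1m.
  by rewrite (der1 (f := id) hd).
rewrite -[v](subrK (v@_m *: u1)); apply: SD; last exact: SZ.
apply: IH; last by apply: VD => //; rewrite -scaleNr; apply: VZ.
rewrite ltnS in le; apply: leq_trans le; apply: (size_msupp_lt (m := m)).
- move=> j; rewrite !supp1; apply: contraNneq => vj.
  rewrite mcoeffB vj !mcoeffZ (_ : u@_j = 0) ?mulr0 ?subr0 //.
  apply/eqP; rewrite -[_ == _]negbK -supp1; apply/negP => /uv.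
  by rewrite supp1 vj eqxx.
- exact: uv.
- by rewrite supp1 negbK mcoeffB mcoeffZ u1m mulr1 subrr.
Qed.

Section SubmoduleOverDomain.
Variables (R : comNzRingType) (F : fieldType) (i : {rmorphism R -> F}).
Hypotheses (hinj : injective i) (hfrac : forall x, exists a b : R, b != 0 /\ x = i a / i b).

Lemma inj_rmorph_neq0 (x : R) : x != 0 -> i x != 0.
Proof. by apply: contra_neq => h; apply: hinj; rewrite h rmorph0. Qed.

Lemma inj_mulf_neq0 (x y : R) : x != 0 -> y != 0 -> x * y != 0.
Proof.
move=> x0 y0; apply: contra_neq x0 => /(congr1 i); rewrite rmorphM rmorph0 => /eqP.
by rewrite mulf_eq0 (negbTE (inj_rmorph_neq0 y0)) orbF => /eqP h; apply: hinj; rewrite h rmorph0.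
Qed.

Lemma map_mx_injective m n (X Y : 'M[R]_(m, n)) : map_mx i X = map_mx i Y -> X = Y.
Proof.
by move/matrixP => h; apply/matrixP => a b; apply: hinj; have := h a b; rewrite !mxE.
Qed.

Lemma common_denominator m n (X : 'M[F]_(m, n)) :
  exists r (Y : 'M[R]_(m, n)), r != 0 /\ i r *: X = map_mx i Y.
Proof.
suff h (s : seq ('I_m * 'I_n)) : exists r, r != 0 /\
    forall x, x \in s -> exists y, i r * X x.1 x.2 = i y.
  have [r [r0 hr]] := h (enum {: 'I_m * 'I_n}).
  have [Y hY] := boolp.choice (fun x : 'I_m * 'I_n => hr x (mem_enum _ x)).
  by exists r, (\matrix_(a, b) Y (a, b)); split=> //; apply/matrixP => a b; rewrite !mxE -hY.
elim: s => [|x s [r [r0 hr]]]; first by exists 1; rewrite oner_neq0.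
have [a [b [b0 hab]]] := hfrac (X x.1 x.2).
exists (b * r); split=> [|y]; first exact: inj_mulf_neq0.
rewrite inE => /orP[/eqP ->|/hr [z hz]].
  exists (r * a); rewrite hab !rmorphM [i b * i r]mulrC -mulrA [i b * _]mulrC divfK //.
  exact: inj_rmorph_neq0.
by exists (b * z); rewrite !rmorphM -mulrA hz.
Qed.

Variables (d : nat) (W : 'rV[R]_d -> Prop).

(** Without a Noetherian hypothesis W need not be finitely generated; a family from W of maximal
    rank over F still generates it up to nonzero factors. *)
Lemma submodule_basis : exists k (B : 'M[R]_(k, d)),
  (forall a, W (row a B)) /\ forall w, W w -> exists r (x : 'rV_k), r != 0 /\ r *: w = x *m B.
Proof.
suff [k [B [WB hB]]] : exists k (B : 'M[R]_(k, d)), (forall a, W (row a B)) /\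
    forall w, W w -> (map_mx i w <= map_mx i B)%MS.
  exists k, B; split=> // w /hB /submxP [X hX].
  have [r [Y [r0 hY]]] := common_denominator X.
  exists r, Y; split=> //; apply: map_mx_injective.
  by rewrite map_mxZ map_mxM hX scalemxAl hY.
pose Q m := exists k (B : 'M[R]_(k, d)), (forall a, W (row a B)) /\ (d - \rank (map_mx i B))%N = m.
have [|m [k [B [WB hm]]] hmin] := @minimizer_exists _ id Q.
  by exists (d - 0)%N, 0%N, 0; split=> [[]//|]; rewrite map_mx0 mxrank0.
exists k, B; split=> // w Ww.
pose B' := col_mx B w.
have /hmin : Q (d - \rank (map_mx i B'))%N.
  exists (k + 1)%N, B'; split=> // a; rewrite -[a]splitK; case: (split a) => b /=.
    by rewrite rowKu.
  by rewrite rowKd [b]ord1 row_id.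
rewrite -hm leq_sub2lE ?rank_leq_col // => hr.
have sub : (map_mx i B <= map_mx i B')%MS by rewrite map_col_mx -addsmxE addsmxSl.
move: hr; rewrite (geq_leqif (mxrank_leqif_sup sub)); apply: submx_trans.
by rewrite map_col_mx -addsmxE addsmxSr.
Qed.

(** Over F the vector v lies outside the span of W, so a column of a cokernel matrix separates them;
    clearing denominators brings it back to R. *)
Lemma separating_functional (v : 'rV[R]_d) : W 0 ->
  (forall x y, W x -> W y -> W (x + y)) -> (forall c x, W x -> W (c *: x)) ->
  (forall r, r != 0 -> ~ W (r *: v)) ->
  exists lam : 'cV[R]_d, (forall w, W w -> w *m lam = 0) /\ v *m lam != 0.
Proof.
move=> W0 WD WZ hv; have [k [B [WB hB]]] := submodule_basis.
have WM (x : 'rV_k) : W (x *m B).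
  by rewrite mulmx_sum_row; apply: (big_ind W) => // a _; apply/WZ/WB.
have hvB : ~~ (map_mx i v <= map_mx i B)%MS.
  apply/negP => /submxP [X hX]; have [r [Y [r0 hY]]] := common_denominator X.
  apply: (hv r r0); suff -> : r *: v = Y *m B by [].
  by apply: map_mx_injective; rewrite map_mxZ map_mxM hX scalemxAl hY.
have [j hj] : exists j, (map_mx i v *m cokermx (map_mx i B)) 0 j != 0.
  have : map_mx i v *m cokermx (map_mx i B) != 0 by rewrite -submxE.
  by move=> /eqP h; apply: boolp.contrapT => h'; apply: h; apply/rowP => j;
    rewrite [RHS]mxE; apply/eqP; apply: boolp.contrapT => /negP hj; apply: h'; exists j.
have [r [lam [r0 hlam]]] := common_denominator (col j (cokermx (map_mx i B))).
have ilam (w : 'rV_d) : map_mx i (w *m lam) = i r *: col j (map_mx i w *m cokermx (map_mx i B)).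
  by rewrite map_mxM -hlam -scalemxAr !colE mulmxA.
exists lam; split=> [w Ww|].
  have [s [x [s0 hs]]] := hB w Ww.
  have hk : map_mx i w *m cokermx (map_mx i B) = 0.
    apply/eqP; rewrite -submxE; apply/submxP; exists ((i s)^-1 *: map_mx i x).
    by rewrite -scalemxAl -map_mxM -hs map_mxZ scalerA mulVf ?scale1r // inj_rmorph_neq0.
  by apply: map_mx_injective; rewrite ilam hk map_mx0 !linear0.
apply: contra_neq (inj_rmorph_neq0 r0) => h.
have /rowP/(_ 0) := ilam v; rewrite h map_mx0 !mxE => /esym/eqP.
by move: hj; rewrite mxE mulf_eq0 => /negbTE ->; rewrite orbF => /eqP.
Qed.

Lemma linear_dependence (q : nat -> 'rV[R]_d) :
  exists k (r : 'I_k -> R), (exists a, r a != 0) /\ \sum_a r a *: q a = 0.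
Proof.
pose M := \matrix_(a < d.+1) q a.
have : kermx (map_mx i M) != 0.
  rewrite -mxrank_eq0 mxrank_ker -lt0n subn_gt0.
  exact: leq_ltn_trans (rank_leq_col _) _.
case/rowV0Pn => x /sub_kermxP hx x0; have [s [y [s0 hy]]] := common_denominator x.
have yM : y *m M = 0.
  by apply: map_mx_injective; rewrite map_mxM -hy -scalemxAl hx scaler0 map_mx0.
exists d.+1, (y 0); split.
  apply: boolp.contrapT => h; case/eqP: x0; apply/rowP => a; rewrite [RHS]mxE.
  have : i s * x 0 a = 0.
    have /rowP/(_ a) := hy; rewrite !mxE => ->.
    have [->|ya] := eqVneq (y 0 a) 0; first by rewrite rmorph0.
    by case: h; exists a.
  by move/eqP; rewrite mulf_eq0 (negbTE (inj_rmorph_neq0 s0)) => /eqP.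
transitivity (y *m M) => //; rewrite mulmx_sum_row; apply: eq_bigr => a _.
by rewrite rowK.
Qed.
End SubmoduleOverDomain.
(** * Ideals of R[X] and constant points *)

Section Specialization.
Variables (n : nat) (R S : comNzRingType) (f : {rmorphism R -> S}).

Lemma map_mpolyE_mxeval (q : {mpoly R[n * n]}) :
  map_mpoly f q = mxeval (@mpolyC (n * n) S \o f) (varmx n S) q.
Proof.
apply: (@mpoly_rmorph_ext _ _ _ (map_mpoly f)) => [c|k] /=.
  by rewrite mxeval_C map_mpolyC ?rmorph0.
by rewrite mxeval_X map_mpolyX -varmxX.
Qed.

(** Monomials are images of monomials and Q absorbs them, so the ideal generated by the image of Q
    is merely its S-linear span. *)
Lemma gen_ideal_span N (Q : {mpoly R[N]} -> Prop) v : is_ideal Q ->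
  gen_ideal (map_mpoly f) Q v ->
  forall T : {mpoly S[N]} -> Prop, T 0 -> (forall x y, T x -> T y -> T (x + y)) ->
  (forall e q, Q q -> T (e *: map_mpoly f q)) -> T v.
Proof.
move=> [Q0 QD QM] hv T T0 TD TQ.
pose U v := forall T : {mpoly S[N]} -> Prop, T 0 -> (forall x y, T x -> T y -> T (x + y)) ->
  (forall e q, Q q -> T (e *: map_mpoly f q)) -> T v.
suff : U v by apply.
apply: hv => [|q Qq T' _ _ h]; last by rewrite -[map_mpoly f q]scale1r; apply: h.
split=> [T' //|x y hx hy T' h0 hD h|a x hx].
  by apply: (hD); [apply: hx | apply: hy].
elim/mpolyind: a => [|c m p _ _ IH]; first by rewrite mul0r => T' ?.
rewrite mulrDl => T' h0 hD h; apply: (hD); last exact: IH.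
apply: (hx (fun z => T' (c *: 'X_[m] * z))) => [|x' y' hx' hy'|e q Qq]; first by rewrite mulr0.
  by rewrite mulrDr; apply: hD.
suff -> : c *: 'X_[m] * (e *: map_mpoly f q) = (c * e) *: map_mpoly f ('X_[m] * q).
  by apply/h/QM.
by rewrite rmorphM /= map_mpolyX -scalerAl -scalerAr scalerA.
Qed.

(* A functional killing the part of bounded degree of an ideal is not changed by enlarging the bound,
   so it kills all elements generated in small degree. *)
Lemma gen_ideal_functional N (Q : {mpoly R[N]} -> Prop) v : is_ideal Q ->
  gen_ideal (map_mpoly f) Q v -> exists K0, forall K, (K0 <= K)%N ->
  forall lam : 'X_{1..N < K} -> R,
  (forall q, Q q -> (msize q <= K)%N -> \sum_m lam m * q@_m = 0) ->
  \sum_m f (lam m) * v@_m = 0.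
Proof.
move=> hQ hv; pose T w := exists K0, forall K, (K0 <= K)%N ->
  forall lam : 'X_{1..N < K} -> R,
  (forall q, Q q -> (msize q <= K)%N -> \sum_m lam m * q@_m = 0) ->
  \sum_m f (lam m) * w@_m = 0.
apply: (gen_ideal_span hQ hv (T := T)) => [|x y [K1 h1] [K2 h2]|e q Qq].
- by exists 0%N => K _ lam _; rewrite big1 // => m _; rewrite mcoeff0 mulr0.
- exists (maxn K1 K2) => K; rewrite geq_max => /andP[le1 le2] lam hlam.
  transitivity (\sum_m f (lam m) * x@_m + \sum_m f (lam m) * y@_m).
    rewrite -big_split /=; by apply: eq_bigr => m _; rewrite mcoeffD mulrDr.
  by rewrite (h1 K) // (h2 K) // addr0.
- exists (msize q) => K le lam /(_ q Qq le) h.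
  transitivity (e * f (\sum_m lam m * q@_m)); last by rewrite h rmorph0 mulr0.
  rewrite rmorph_sum mulr_sumr; apply: eq_bigr => m _.
  by rewrite mcoeffZ mcoeff_map_mpoly rmorphM mulrCA.
Qed.
End Specialization.

Section CoefficientVectors.
Variables (R : comNzRingType) (F : fieldType) (i : {rmorphism R -> F}) (N K : nat).
Hypotheses (hinj : injective i) (hfrac : forall x, exists a b : R, b != 0 /\ x = i a / i b).
Local Notation d := #|{: 'X_{1..N < K}}|.
Implicit Types (q v : {mpoly R[N]}).

Definition cvec q : 'rV[R]_d := \row_(a < d) q@_(val (enum_val a)).

Lemma cvec_inj q v : (msize q <= K)%N -> (msize v <= K)%N -> cvec q = cvec v -> q = v.
Proof.
move=> hq hv /rowP h; rewrite (mpolywE hq) (mpolywE hv); apply: eq_bigr => m _.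
by congr (_ *: _); have := h (enum_rank m); rewrite !mxE enum_rankK.
Qed.

Lemma cvecD q v : cvec (q + v) = cvec q + cvec v.
Proof. by apply/rowP => a; rewrite !mxE mcoeffD. Qed.

Lemma cvecZ c q : cvec (c *: q) = c *: cvec q.
Proof. by apply/rowP => a; rewrite !mxE mcoeffZ. Qed.

Lemma cvec0 : cvec 0 = 0.
Proof. by apply/rowP => a; rewrite !mxE mcoeff0. Qed.

Lemma cvec_sum I (r : seq I) (c : I -> R) (q : I -> {mpoly R[N]}) :
  cvec (\sum_(a <- r) c a *: q a) = \sum_(a <- r) c a *: cvec (q a).
Proof. by rewrite (big_morph cvec cvecD cvec0); apply: eq_bigr => a _; rewrite cvecZ. Qed.

Lemma msize_lincomb I (r : seq I) (c : I -> R) (q : I -> {mpoly R[N]}) :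
  (forall a, (msize (q a) <= K)%N) -> (msize (\sum_(a <- r) c a *: q a) <= K)%N.
Proof.
move=> h; apply: (big_ind (fun p => (msize p <= K)%N)) => [|x y hx hy|a _].
- by rewrite msize0.
- by apply: leq_trans (msizeD_le _ _) _; rewrite geq_max hx.
- by apply: leq_trans (msizeZ_le _ _) _.
Qed.

Lemma mpoly_dependence (q : nat -> {mpoly R[N]}) : (forall a, (msize (q a) <= K)%N) ->
  exists k (r : 'I_k -> R), (exists a, r a != 0) /\ \sum_a r a *: q a = 0.
Proof.
move=> hq; have [k [r [r0 h]]] := linear_dependence hinj hfrac (fun a => cvec (q a)).
exists k, r; split=> //; apply: cvec_inj; rewrite ?msize0 ?cvec_sum ?cvec0 //.
by apply: msize_lincomb => a; apply: hq.
Qed.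

Variable Q : {mpoly R[N]} -> Prop.

Lemma mpoly_submodule_basis : exists k (b : 'I_k -> {mpoly R[N]}),
  (forall a, Q (b a)) /\ forall q, Q q -> (msize q <= K)%N ->
  exists r (x : 'I_k -> R), r != 0 /\ r *: q = \sum_a x a *: b a.
Proof.
have [k [B [WB hB]]] := submodule_basis hinj hfrac
  (fun w => exists q, [/\ Q q, (msize q <= K)%N & w = cvec q]).
have [b hb] := boolp.choice WB; exists k, b; split=> [a|q Qq hq]; first by case: (hb a).
have [|r [x [r0 hx]]] := hB (cvec q); first by exists q.
exists r, (x 0); split=> //; apply: cvec_inj.
- by apply: leq_trans (msizeZ_le _ _) _.
- by apply: msize_lincomb => a; case: (hb a).
rewrite cvecZ hx cvec_sum mulmx_sum_row; apply: eq_bigr => a _.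
by case: (hb a) => _ _ ->.
Qed.

Lemma mpoly_separating_functional v : (msize v <= K)%N -> Q 0 ->
  (forall x y, Q x -> Q y -> Q (x + y)) -> (forall c x, Q x -> Q (c *: x)) ->
  (forall r, r != 0 -> ~ Q (r *: v)) ->
  exists lam : 'X_{1..N < K} -> R,
    (forall q, Q q -> (msize q <= K)%N -> \sum_m lam m * q@_m = 0) /\
    \sum_m lam m * v@_m != 0.
Proof.
move=> hv Q0 QD QZ hQv.
have [||||lam [h1 h2]] := @separating_functional _ _ _ hinj hfrac _
  (fun w => exists q, [/\ Q q, (msize q <= K)%N & w = cvec q]) (cvec v).
- by exists 0; rewrite msize0 cvec0.
- move=> _ _ [x [Qx hx ->]] [y [Qy hy ->]]; exists (x + y); rewrite cvecD; split=> //.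
    exact: QD.
  by apply: leq_trans (msizeD_le _ _) _; rewrite geq_max hx.
- move=> c _ [x [Qx hx ->]]; exists (c *: x); rewrite cvecZ; split=> //; first exact: QZ.
  by apply: leq_trans (msizeZ_le _ _) _.
- move=> r r0 [q [Qq hq]]; rewrite -cvecZ => /cvec_inj e; apply: (hQv r r0).
  by rewrite e //; apply: leq_trans (msizeZ_le _ _) _.
have e q : (cvec q *m lam) 0 0 = \sum_m lam (enum_rank m) 0 * q@_m.
  rewrite mxE (reindex enum_rank) /=; last first.
    by exists enum_val => a _; rewrite ?enum_rankK ?enum_valK.
  by apply: eq_bigr => m _; rewrite !mxE enum_rankK mulrC.
exists (fun m => lam (enum_rank m) 0); split=> [q Qq hq|].
  by rewrite -e h1 ?mxE //; exists q.
by rewrite -e; apply: contra_neq h2 => h; apply/matrixP => a b; rewrite !ord1 h mxE.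
Qed.
End CoefficientVectors.

Lemma map_mx_der_scaled (R E S : comNzRingType) (f : {rmorphism R -> E}) (g : {rmorphism E -> S})
    (dE : E -> E) (D : S -> S) n (A : 'M[R]_n) (Y : 'M[E]_n) (X : 'M[S]_n) :
  isDerivation D -> (forall x, D (g x) = g (dE x)) -> map_mx D X = 0 ->
  map_mx dE Y = map_mx f A *m Y ->
  map_mx D (map_mx g Y *m X) = map_mx (g \o f) A *m (map_mx g Y *m X).
Proof.
move=> hD hg hX hY; rewrite map_mx_derM // hX mulmx0 addr0 mulmxA; congr (_ *m _).
rewrite map_mx_comp -map_mxM -hY -!map_mx_comp; exact: eq_map_mx.
Qed.

Lemma mpoly_lift (R S : comNzRingType) (f : {rmorphism R -> S}) N (v : {mpoly S[N]}) :
  (forall m, exists x, v@_m = f x) -> exists p, map_mpoly f p = v.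
Proof.
move=> /boolp.choice [g hg]; exists (\sum_(m <- msupp v) g m *: 'X_[m]).
rewrite raddf_sum [RHS]mpolyE; apply: eq_bigr => m _ /=.
by rewrite -!mul_mpolyC rmorphM /= map_mpolyX map_mpolyC ?rmorph0 // hg.
Qed.

Section LeftTranslation.
Variables (n : nat) (R E : comNzRingType) (f : {rmorphism R -> E}) (Y : 'M[E]_n).

(* q(X) |-> q(Y X), from R[X] to E[X]. *)
Definition ltrans : {mpoly R[n * n]} -> {mpoly E[n * n]} :=
  mxeval (@mpolyC (n * n) E \o f) (map_mx (@mpolyC (n * n) E) Y *m varmx n E).

Lemma mxeval_ltrans (S : comNzRingType) (k : {rmorphism E -> S}) (X : 'M[S]_n) q :
  mxeval k X (ltrans q) = mxeval (k \o f) (map_mx k Y *m X) q.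
Proof.
rewrite /ltrans mxeval_comp.
have -> : map_mx (mxeval k X) (map_mx (@mpolyC (n * n) E) Y *m varmx n E) = map_mx k Y *m X.
  rewrite map_mxM mxeval_gen -map_mx_comp; congr (_ *m _).
  by apply: eq_map_mx => c; apply: mxeval_C.
by apply: mxeval_eq => c /=; rewrite mxeval_C.
Qed.

(** With constant variables, Y X solves the same system as Y. Left translation thus turns [lder]
    into the coefficientwise derivation, to which [constant_descent] applies. *)
Lemma ltrans_der (dR : R -> R) (dE : E -> E) (A : 'M[R]_n) :
  isDerivation dR -> isDerivation dE -> (forall x, dE (f x) = f (dR x)) ->
  map_mx dE Y = map_mx f A *m Y ->
  forall q, dcoef dE (ltrans q) = ltrans (lder dR A q).
Proof.
move=> hR hE hf hdY q; have hD := dcoef_der (n * n) hE.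
apply: (lder_eval hR hD) => [x|]; first by rewrite /= dcoefC // hf.
apply: (map_mx_der_scaled (g := @mpolyC (n * n) E) hD) hdY => [x|]; first by rewrite /= dcoefC.
by apply/matrixP => i j; rewrite [LHS]mxE [RHS]mxE varmxE dcoefX.
Qed.
End LeftTranslation.

Section DiffIdealPoint.
Variables (C : closedFieldType) (R : comNzRingType) (E : fieldType).
Variables (dR : R -> R) (dE : E -> E) (f : {rmorphism R -> E}) (c : {rmorphism C -> E}).
Variables (n : nat) (A : 'M[R]_n) (Y : 'M[E]_n).
Hypotheses (hR : isDerivation dR) (hE : isDerivation dE).
Hypothesis hf : forall x, dE (f x) = f (dR x).
Hypothesis hconst : forall e, dE e = 0 -> exists x, e = c x.
Hypotheses (hY : Y \in unitmx) (hdY : map_mx dE Y = map_mx f A *m Y).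
Variable Q : {mpoly R[n * n]} -> Prop.
Hypothesis hQ : forall q, Q q -> Q (lder dR A q).

(** The ideal of the q(Y X) is stable under the coefficientwise derivation, so by descent it is
    spanned by its elements over C; vanishing at M needs checking only on these. *)
Lemma ltrans_vanish (M : 'M[C]_n) :
  (forall p, gen_ideal (ltrans f Y) Q (map_mpoly c p) -> mxeval idfun M p = 0) ->
  forall q, Q q -> mxeval f (Y *m map_mx c M) q = 0.
Proof.
move=> hM; set V := gen_ideal _ _ in hM.
have [_ VD VM] : is_ideal V := gen_idealP _ _.
have key v : V v -> mxeval idfun (map_mx c M) v = 0.
  apply: (constant_descent hE (V := V) (S := fun v => mxeval idfun (map_mx c M) v = 0)).
  - exact: VD.
  - by move=> e w Vw; rewrite -mul_mpolyC; apply: VM.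
  - apply: gen_ideal_der; first exact: dcoef_der.
    by move=> q Qq; rewrite (ltrans_der hR hE hf hdY); apply: gen_ideal_in; apply: hQ.
  - exact: rmorph0.
  - by move=> v1 v2 h1 h2; rewrite rmorphD /= h1 h2 addr0.
  - by move=> e w h; rewrite -mul_mpolyC rmorphM /= h mulr0.
  move=> w Vw hw; have [p hp] : exists p, map_mpoly c p = w.
    by apply: mpoly_lift => m; apply: hconst.
  have h : mxeval idfun M p = 0 by apply: hM; rewrite hp.
  rewrite -hp map_mpolyE_mxeval mxeval_comp mxeval_gen.
  rewrite (mxeval_eq _ (g := c \o idfun)) => [|e]; last by rewrite /= mxeval_C.
  by rewrite -mxeval_comp h rmorph0.
move=> q Qq; have := key _ (gen_ideal_in (f := ltrans f Y) Qq).
rewrite mxeval_ltrans map_mx_id // => <-; exact: mxeval_eq.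
Qed.

(** The substitution of Y^-1 X for X carries q(Y X) back to q and multiplies det X by a unit. *)
Let det_in m : gen_ideal (ltrans f Y) Q (\det (varmx n E) ^+ m) ->
  gen_ideal (map_mpoly f) Q (\det (varmx n E) ^+ m).
Proof.
have [_ _ hM] := gen_idealP (map_mpoly f) Q.
pose gC : {rmorphism E -> {mpoly E[n * n]}} := @mpolyC (n * n) E.
pose h : {rmorphism {mpoly E[n * n]} -> {mpoly E[n * n]}} :=
  mxeval gC (map_mx gC (invmx Y) *m varmx n E).
have hq q : h (ltrans f Y q) = map_mpoly f q.
  rewrite /h /= mxeval_ltrans mulmxA -map_mxM mulmxV // map_mx1 mul1mx.
  by rewrite map_mpolyE_mxeval; apply: mxeval_eq.
move=> hV; have : gen_ideal (map_mpoly f) Q (h (\det (varmx n E) ^+ m)).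
  apply: (gen_ideal_map (h := h) (gen_idealP (map_mpoly f) Q) _ hV) => q Qq.
  by rewrite hq; apply: gen_ideal_in.
rewrite /h /= mxeval_det det_mulmx exprMn => /(hM (gC (\det Y) ^+ m)).
rewrite mulrA -exprMn det_map_mx -rmorphM det_inv mulrV; last by rewrite -unitmxE.
by rewrite rmorph1 expr1n mul1r.
Qed.

Lemma diff_ideal_point :
  (forall m, ~ gen_ideal (map_mpoly f) Q (\det (varmx n E) ^+ m)) ->
  exists M : 'M[C]_n, M \in unitmx /\
    forall q, Q q -> mxeval f (Y *m map_mx c M) q = 0.
Proof.
move=> hdet.
pose I0 p := gen_ideal (ltrans f Y) Q (map_mpoly c p).
have hI0 : is_ideal I0.
  have [V0 VD VM] := gen_idealP (ltrans f Y) Q; rewrite /I0.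
  split=> [|x y|a x]; first by rewrite rmorph0.
    by rewrite rmorphD; apply: VD.
  by rewrite rmorphM; apply: VM.
have hI0d m : ~ I0 (\det (varmx n C) ^+ m).
  by rewrite /I0 map_mpolyE_mxeval mxeval_det => /det_in; apply: hdet.
have [x [hx hxd]] := nullstellensatz hI0 hI0d.
pose M : 'M[C]_n := vec_mx (\row_k x k).
have xM p : p.@[x] = mxeval idfun M p.
  apply: (@mpoly_rmorph_ext _ _ _ (meval x)) => [e|k] /=; first by rewrite mxeval_C mevalC.
  by rewrite mxeval_X mevalXU /M vec_mxK mxE.
exists M; split.
  by move: hxd; rewrite xM -[\det _]expr1 mxeval_det expr1 unitmxE unitfE.
by apply: ltrans_vanish => p /hx; rewrite xM.
Qed.
End DiffIdealPoint.
(** * Relations between the entries of a fundamental matrix *)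

Section FractionConstants.
Variables (C : fieldType) (l : nat) (R : comNzRingType).
Variables (cR : {rmorphism C -> R}) (dR : R -> R) (t : 'I_l -> R).
Hypotheses (hchar : [pchar C] =i pred0) (hR : is_diff_poly_ring cR dR t).
Variables (F : fieldType) (dF : F -> F) (i : {rmorphism R -> F}).
Hypothesis hF : is_diff_frac_field dR dF i.

Let hd : isDerivation dR := hR.1.1.
Let hi : injective i := hF.2.1.

Let cancel (b x y : R) : b != 0 -> b * x = b * y -> x = y.
Proof.
move=> b0 /(congr1 i); rewrite !rmorphM => /(mulfI (inj_rmorph_neq0 hi b0)); exact: hi.
Qed.

(* If d(a/b) = 0 then all partial derivatives of a/b vanish: they do for large indices,
   and partial j k is a commutator of partial j (k+1) with d. *)
Let partial_const_frac a b : b != 0 -> dR a * b = a * dR b ->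
  forall j k, partial hR j k a * b = a * partial hR j k b.
Proof.
move=> b0 hab j.
have [K1 h1] := partial_fin hR a; have [K2 h2] := partial_fin hR b.
have big k : (maxn K1 K2 <= k)%N -> partial hR j k a * b = a * partial hR j k b.
  by rewrite geq_max => /andP[le1 le2]; rewrite h1 // h2 // mul0r mulr0.
suff down m k : (maxn K1 K2 - m <= k)%N -> partial hR j k a * b = a * partial hR j k b.
  by move=> k; apply: (down (maxn K1 K2)); rewrite subnn.
elim: m k => [|m IH] k hk; first by apply: big; rewrite subn0 in hk.
have hk1 : partial hR j k.+1 a * b = a * partial hR j k.+1 b.
  by apply: IH; move: hk; rewrite subnS; case: (_ - _)%N.
have hp := partial_der hR j k.+1.
have e1 : partial hR j k.+1 (dR a * b) = partial hR j k.+1 (a * dR b) by rewrite hab.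
have e2 : dR (partial hR j k.+1 a * b) = dR (a * partial hR j k.+1 b) by rewrite hk1.
rewrite !(derM (f := id) hp) !partial_d /= in e1.
rewrite !(derM (f := id) hd) /= in e2.
set x := partial hR j k.+1 a in hk1 e1 e2 *; set y := partial hR j k.+1 b in hk1 e1 e2 *.
set u := partial hR j k a in e1 *; set v := partial hR j k b in e1 *.
have e3 : x * dR b = dR a * y.
  apply: (cancel b0); rewrite mulrA [b * x]mulrC hk1 [RHS]mulrA [b * dR a]mulrC hab; ring.
have : u * b - a * v = (dR x + u) * b + dR a * y - (x * dR b + a * (dR y + v))
    - (dR x * b + x * dR b - (dR a * y + a * dR y)) + (x * dR b - dR a * y) *+ 2 by ring.
by rewrite e1 e2 e3 !subrr mul0rn ?subr0 addr0 => /eqP; rewrite subr_eq0 => /eqP.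
Qed.

(** All partial derivatives of a/b vanish, so its ideal of denominators J is stable under them and
    contains 1. Hence a/b lies in R, and [partials_kernel] finishes. *)
Lemma frac_constants x : dF x = 0 -> exists c, x = i (cR c).
Proof.
have [hdF [_ [hid hfr]]] := hF; have [a [b [b0 xab]]] := hfr x => dx.
have ib := inj_rmorph_neq0 hi b0.
have hab : dR a * b = a * dR b.
  apply: hi; rewrite !rmorphM !hid.
  have e : i a = x * i b by rewrite xab divfK.
  by rewrite e (derM (f := id) hdF) dx mul0r add0r mulrAC.
have hpc := partial_const_frac b0 hab.
have [s hs] : exists s, i 1 * i a = i s * i b; last first.
  have xs : x = i s by rewrite xab -[i a]mul1r -(rmorph1 i) hs mulfK.
  have [|c hc] := partials_kernel hchar (hR := hR) (x := s); last by exists c; rewrite xs hc.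
  move=> j k; rewrite -[LHS]mulr1 partial_const_frac ?oner_neq0 //.
    by rewrite (der1 (f := id) (partial_der hR j k)) // mulr0.
  rewrite (der1 (f := id) hd) // mulr0 mulr1; apply: hi.
  by rewrite hid -xs dx rmorph0.
pose J r := exists s, i r * i a = i s * i b.
suff : J 1 by [].
apply: (partials_simple (hR := hR) hchar (J := J)); last by exists b => //; exists a; rewrite mulrC.
  split=> [|r1 r2 [s1 h1] [s2 h2]|r1 r2 [s2 h2]].
  - by exists 0; rewrite rmorph0 !mul0r.
  - by exists (s1 + s2); rewrite !rmorphD !mulrDl h1 h2.
  - by exists (r1 * s2); rewrite !rmorphM -!mulrA h2.
move=> j k r [s hs]; exists (partial hR j k s).
have hs' : r * a = s * b by apply: hi; rewrite !rmorphM.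
have hp := partial_der hR j k.
have := congr1 (partial hR j k) hs'; rewrite !(derM (f := id) hp) /= => e.
rewrite -!rmorphM; congr (i _); apply: (cancel b0).
have h := hpc j k.
have -> : b * (partial hR j k r * a) =
    b * (partial hR j k r * a + r * partial hR j k a) - r * (partial hR j k a * b) by ring.
rewrite e h; have -> : r * (a * partial hR j k b) = (r * a) * partial hR j k b by ring.
rewrite hs'; ring.
Qed.
End FractionConstants.

Section Connection.
Variables (C : fieldType) (l n : nat) (R : comNzRingType).
Variables (cR : {rmorphism C -> R}) (dR : R -> R) (t : 'I_l -> R).
Hypothesis hR : is_diff_poly_ring cR dR t.
Variable A : 'M[R]_n.

Let hd : isDerivation dR := hR.1.1.

Lemma partial_fin_seq (s : seq R) :
  exists K, forall x, x \in s -> forall j k, (K <= k)%N -> partial hR j k x = 0.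
Proof.
elim: s => [|x s [K hK]]; first by exists 0%N.
have [K' hK'] := partial_fin hR x; exists (maxn K K') => y.
rewrite inE => /orP[/eqP ->|ys] j k; rewrite geq_max => /andP[h1 h2]; first exact: hK'.
exact: hK.
Qed.

(* Extend each partial j k to R[X] by X' = B j k X so that
   [partial j (k+1), d] = partial j k still holds; B vanishes for large k and is
   determined downwards. *)
Lemma connection_exists : exists B : 'I_l -> nat -> 'M[R]_n,
  (exists K, forall j k, (K <= k)%N -> B j k = 0) /\
  forall j k, B j k = map_mx (partial hR j k.+1) A + A *m B j k.+1
                      - map_mx dR (B j k.+1) - B j k.+1 *m A.
Proof.
have [K hK] := partial_fin_seq [seq A ab.1 ab.2 | ab : 'I_n * 'I_n].
have pA j k : (K <= k)%N -> map_mx (partial hR j k) A = 0.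
  move=> le; apply/matrixP => a b; rewrite !mxE (hK (A a b)) //.
  by apply/mapP; exists (a, b); rewrite ?mem_enum.
pose step j k (M : 'M[R]_n) :=
  map_mx (partial hR j k.+1) A + A *m M - map_mx dR M - M *m A.
(* [G j m] is the matrix of index K - m; truncated subtraction makes [G j (K - k)] zero for every k
   from K on. *)
pose G j := fix G m := if m is m'.+1 then step j (K - m)%N (G m') else 0.
have d0 : map_mx dR (0 : 'M[R]_n) = 0.
  by apply/matrixP => a b; rewrite !mxE (der0 (f := id) hd).
exists (fun j k => G j (K - k)%N); split=> [|j k].
  by exists K => j k; rewrite -subn_eq0 => /eqP ->.
have [le|lt] := leqP K k.
  have [-> ->] : (K - k = 0)%N /\ (K - k.+1 = 0)%N.
    by split; apply/eqP; rewrite subn_eq0 // leqW.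
  by rewrite /= d0 mulmx0 mul0mx !subr0 addr0 pA // leqW.
have -> : (K - k = (K - k.+1).+1)%N by rewrite subnS prednK // subn_gt0.
rewrite /= -/(step j k (G j (K - k.+1)%N)); congr step.
by rewrite subnSK // subKn // ltnW.
Qed.

Variables (F : fieldType) (i : {rmorphism R -> F}).
Hypotheses (hi : injective i) (hfr : forall x, exists a b : R, b != 0 /\ x = i a / i b).
Variables (B : 'I_l -> nat -> 'M[R]_n).
Hypotheses (hB0 : exists K, forall j k, (K <= k)%N -> B j k = 0)
  (hB : forall j k, B j k = map_mx (partial hR j k.+1) A + A *m B j k.+1
                      - map_mx dR (B j k.+1) - B j k.+1 *m A).

Lemma connection_commutator j k q :
  lder (partial hR j k) (B j k) q =
  lder (partial hR j k.+1) (B j k.+1) (lder dR A q) -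
  lder dR A (lder (partial hR j k.+1) (B j k.+1) q).
Proof.
apply: lder_commutator (hB j k) q => [|||x] //; try exact: partial_der.
by rewrite partial_d addrC addKr.
Qed.

(* In bounded degree the relations have a basis over F, whose coefficients are killed by
   partial j k for k large; the commutator relation then descends to all k. *)
Lemma relations_stable (I : {mpoly R[n * n]} -> Prop) : is_ideal I ->
  (forall r q, r != 0 -> I (r *: q) -> I q) -> (forall q, I q -> I (lder dR A q)) ->
  forall j k q, I q -> I (lder (partial hR j k) (B j k) q).
Proof.
move=> hI Isat Id j k q Iq; have [_ ID IM] := hI.
pose K := msize q; have hq : (msize q <= K)%N by [].
have [s [b [Ib hb]]] := mpoly_submodule_basis K hi hfr I.
have [K1 hK1] := hB0.
have [K2 hK2] := partial_fin_seq
  (flatten [seq [seq (b a)@_m | m <- msupp (b a)] | a : 'I_s]).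
pose k0 := maxn K1 K2.
have base m p : (k0 <= m)%N -> I p -> (msize p <= K)%N ->
    I (lder (partial hR j m) (B j m) p).
  rewrite geq_max => /andP[le1 le2] Ip hp; have hpd := partial_der hR j m.
  have hl := lder_der (B j m) hpd.
  have [r [x [r0 hx]]] := hb p Ip hp; apply: (Isat r) => //.
  have e : lder (partial hR j m) (B j m) (r *: p) =
      (partial hR j m r)%:MP * p + r *: lder (partial hR j m) (B j m) p.
    by rewrite -mul_mpolyC (derM (f := id) hl) lderC // -[r *: _]mul_mpolyC.
  have -> : r *: lder (partial hR j m) (B j m) p =
      lder (partial hR j m) (B j m) (r *: p) - (partial hR j m r)%:MP * p.
    by rewrite e addrC addKr.
  apply: idealB => //; last exact: IM.
  rewrite hx (der_sum (f := id) hl); apply: ideal_sum => // a _.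
  rewrite -mul_mpolyC (derM (f := id) hl); apply: ID.
    by rewrite /= ; apply: IM.
  suff -> : lder (partial hR j m) (B j m) (b a) = 0 by rewrite mulr0; case: hI.
  rewrite hK1 // lder0; apply/mpolyP => u; rewrite mcoeff_dcoef // mcoeff0.
  have [us|/memN_msupp_eq0 ->] := boolP (u \in msupp (b a)); last first.
    by rewrite (der0 (f := id) hpd).
  apply: hK2 => //; apply/flattenP; exists [seq (b a)@_m | m <- msupp (b a)].
    by apply/mapP; exists a; rewrite ?mem_enum.
  by apply/mapP; exists u.
(* The element p stays general because the commutator also applies the derivation to [lder dR A p],
   which respects the same degree bound. *)
suff down m k' p : (k0 - m <= k')%N -> I p -> (msize p <= K)%N ->
    I (lder (partial hR j k') (B j k') p).
  by apply: (down k0) => //; rewrite subnn.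
elim: m k' p => [|m IH] k' p hk Ip hp; first by apply: base; rewrite ?subn0 in hk *.
have hk1 : (k0 - m <= k'.+1)%N by move: hk; rewrite subnS; case: (_ - _)%N.
rewrite connection_commutator; apply: idealB => //.
  by apply: IH => //; [apply: Id | apply: msize_lder].
by apply: Id; apply: IH.
Qed.
End Connection.

(** * Right translation and the relations of a fundamental matrix *)

Lemma msizeM_bound (R : nzRingType) N (p q : {mpoly R[N]}) a b :
  (msize p <= a.+1)%N -> (msize q <= b.+1)%N -> (msize (p * q) <= (a + b).+1)%N.
Proof.
move=> hp hq; rewrite (msizeE (p * q)); apply/bigmax_leqP_seq => m /msuppM_le.
case/allpairsP => -[m1 m2] /= [h1 h2 ->] _; rewrite mdegD ltnS.
apply: leq_add; rewrite -ltnS.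
  by apply: leq_trans hp; apply: msize_mdeg_lt.
by apply: leq_trans hq; apply: msize_mdeg_lt.
Qed.

Section RightTranslation.
Variables (n : nat) (R : comNzRingType).

Definition rtrans (M : 'M[R]_n) : {mpoly R[n * n]} -> {mpoly R[n * n]} :=
  mxeval (@mpolyC (n * n) R) (varmx n R *m map_mx (@mpolyC (n * n) R) M).
HB.instance Definition _ M := GRing.RMorphism.copy (rtrans M)
  (mxeval (@mpolyC (n * n) R) (varmx n R *m map_mx (@mpolyC (n * n) R) M)).

Lemma rtransZ M c q : rtrans M (c *: q) = c *: rtrans M q.
Proof. by rewrite -!mul_mpolyC rmorphM /= /rtrans mxeval_C. Qed.

Lemma mxeval_rtrans (S : comNzRingType) (f : {rmorphism R -> S}) (Y : 'M[S]_n) M q :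
  mxeval f Y (rtrans M q) = mxeval f (Y *m map_mx f M) q.
Proof.
rewrite /rtrans mxeval_comp; have -> : map_mx (mxeval f Y)
    (varmx n R *m map_mx (@mpolyC (n * n) R) M) = Y *m map_mx f M.
  rewrite map_mxM mxeval_gen -map_mx_comp; congr (_ *m _).
  by apply: eq_map_mx => c; apply: mxeval_C.
by apply: mxeval_eq => c /=; rewrite mxeval_C.
Qed.

Lemma rtransK (M M' : 'M[R]_n) q : M *m M' = 1%:M -> rtrans M (rtrans M' q) = q.
Proof.
move=> h; rewrite {1}/rtrans mxeval_rtrans -mulmxA -map_mxM h map_mx1 mulmx1.
by apply/esym; apply: (@mxeval_unique _ _ _ (@mpolyC (n * n) R) (varmx n R) idfun) => //;
  apply: map_mx_id.
Qed.

Lemma msize_rtrans M K q : (msize q <= K)%N -> (msize (rtrans M q) <= K)%N.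
Proof.
move=> hq; rewrite (mpolywE hq) raddf_sum; apply: leq_trans (msize_sum _ _ _) _.
apply/bigmax_leqP_seq => m _ _ /=; rewrite rtransZ; apply: leq_trans (msizeZ_le _ _) _.
apply: leq_trans (bmdeg m); move: (val m) => {}m.
have hX k : (msize (rtrans M 'X_k) <= 2)%N.
  rewrite /rtrans mxeval_X; case/mxvec_indexP: k => i j; rewrite mxvecE mxE.
  apply: leq_trans (msize_sum _ _ _) _; apply/bigmax_leqP_seq => k _ _.
  rewrite varmxE mxE mulrC mul_mpolyC; apply: leq_trans (msizeZ_le _ _) _.
  by rewrite msizeX mdeg1.
rewrite mpolyXE_id rmorph_prod /= mdegE.
apply: (big_ind2 (fun p d => (msize p <= d.+1)%N)) => [|p a p' b h h'|k _].
- by rewrite msize1.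
- exact: msizeM_bound.
rewrite rmorphXn /=; elim: (m k) => [|d IH]; first by rewrite expr0 msize1.
by rewrite exprS; apply: (@msizeM_bound _ _ _ _ 1 d).
Qed.
End RightTranslation.

Section Relations.
Variables (R : comNzRingType) (F : fieldType) (i : {rmorphism R -> F}).
Hypotheses (hi : injective i) (hfr : forall x, exists a b : R, b != 0 /\ x = i a / i b).
Variables (n : nat) (E : fieldType) (f : {rmorphism R -> E}) (Y : 'M[E]_n).
Hypothesis hf : injective f.

Definition relations (q : {mpoly R[n * n]}) := mxeval f Y q = 0.

Lemma relations_ideal : is_ideal relations.
Proof.
rewrite /relations; split=> [|x y hx hy|a x hx]; first exact: rmorph0.
  by rewrite rmorphD /= hx hy addr0.
by rewrite rmorphM /= hx mulr0.
Qed.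

Lemma relations_sat r q : r != 0 -> relations (r *: q) -> relations q.
Proof.
move=> r0; rewrite /relations -mul_mpolyC rmorphM /= mxeval_C => /eqP.
by rewrite mulf_eq0 (negbTE (inj_rmorph_neq0 hf r0)) => /eqP.
Qed.

(* In bounded degree, right translation by M is injective on a finite-dimensional space,
   hence maps the relations onto themselves. *)
Lemma relations_mulr_inv (M M' : 'M[R]_n) : M *m M' = 1%:M ->
  (forall q, relations q -> mxeval f (Y *m map_mx f M) q = 0) ->
  forall q, mxeval f (Y *m map_mx f M) q = 0 -> relations q.
Proof.
move=> hM hI q hq; have [I0 ID IM] := relations_ideal.
have IT p : relations p -> relations (rtrans M p).
  by rewrite /relations mxeval_rtrans; apply: hI.
have Iq : relations (rtrans M q) by rewrite /relations mxeval_rtrans.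
(* These are the preimages of q under iterated right translation by M; their degrees stay bounded,
   so they are linearly dependent over R. *)
pose u k := iter k (rtrans M') q.
have hu k : (msize (u k) <= msize q)%N by elim: k => //= k; apply: msize_rtrans.
have uT k a : iter k (rtrans M) (u (k + a)%N) = u a.
  by elim: k => //= k IH; rewrite -iterS iterSr /= rtransK.
have uTS m : relations (iter m.+1 (rtrans M) q).
  by elim: m => [|m IH]; [exact: Iq | rewrite iterS; apply: IT].
have uI k a : (a < k)%N -> relations (iter k (rtrans M) (u a)).
  move=> lt; rewrite -(subnK (ltnW lt)) iterD; have := uT a 0%N; rewrite addn0 => ->.
  by rewrite -(prednK (n := (k - a)%N)) ?subn_gt0 //; apply: uTS.
have [k [r [[a0 ra0] hr]]] := mpoly_dependence hi hfr hu.
have [|a ra amax] := @minimizer_exists _ (fun a : 'I_k => (k - a)%N) (fun a => r a != 0).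
  by exists a0.
have iterS_sum m (s : seq 'I_k) (P : pred 'I_k) : iter m (rtrans M) (\sum_(b <- s | P b) r b *: u b) =
    \sum_(b <- s | P b) r b *: iter m (rtrans M) (u b).
  elim: m => //= m ->; rewrite raddf_sum; apply: eq_bigr => b _ /=; exact: rtransZ.
(* For the largest a with r_a nonzero, translating a times turns [u a] into q and every lower term
   into a relation. *)
have := congr1 (iter a (rtrans M)) hr; rewrite iterS_sum (bigD1 a) //=.
have := uT a 0%N; rewrite addn0 /= => ->; rewrite (_ : iter a (rtrans M) 0 = 0); last first.
  by elim: (val a) => //= m ->; rewrite rmorph0.
move/eqP; rewrite addr_eq0 => /eqP e; apply: (relations_sat ra); rewrite e.
apply: idealN; first exact: relations_ideal.
apply: ideal_sum; first exact: relations_ideal.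
move=> b ba; have [->|rb] := eqVneq (r b) 0; first by rewrite scale0r.
rewrite -mul_mpolyC; apply: IM; apply: uI.
have := amax b rb; rewrite leq_sub2lE; last exact: ltnW.
by rewrite leq_eqVlt (inj_eq val_inj) (negbTE ba).
Qed.
End Relations.

(** * Simplicity and good reduction of the ideal of relations *)

Section GenericRelations.
Variables (C : closedFieldType) (l n : nat) (R : comNzRingType).
Variables (cR : {rmorphism C -> R}) (dR : R -> R) (t : 'I_l -> R).
Hypotheses (hchar : [pchar C] =i pred0) (hR : is_diff_poly_ring cR dR t).
Variables (F : fieldType) (i : {rmorphism R -> F}).
Hypotheses (hi : injective i) (hfr : forall x, exists a b : R, b != 0 /\ x = i a / i b).
Variables (A : 'M[R]_n) (B : 'I_l -> nat -> 'M[R]_n).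
Hypotheses (hB0 : exists K, forall j k, (K <= k)%N -> B j k = 0)
  (hB : forall j k, B j k = map_mx (partial hR j k.+1) A + A *m B j k.+1
                      - map_mx dR (B j k.+1) - B j k.+1 *m A).
Variables (E : fieldType) (dE : E -> E) (f : {rmorphism R -> E}) (Y : 'M[E]_n).
Hypotheses (hE : isDerivation dE) (hf : injective f) (hfd : forall x, dE (f x) = f (dR x)).
Hypotheses (hY : Y \in unitmx) (hdY : map_mx dE Y = map_mx f A *m Y).
Hypothesis hconst : forall e, dE e = 0 -> exists c, e = f (cR c).

Let hd : isDerivation dR := hR.1.1.
Let D := lder dR A.
Let Dp j k := lder (partial hR j k) (B j k).
Let I := relations f Y.

Lemma relations_D q : I q -> I (D q).
Proof.
by rewrite /I /relations /D => h; rewrite -(lder_eval hd hE hfd hdY) h (der0 (f := id) hE).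
Qed.

Lemma relations_Dp j k q : I q -> I (Dp j k q).
Proof.
apply: (relations_stable hi hfr hB0 hB (relations_ideal f Y)).
  by move=> r p; apply: relations_sat.
exact: relations_D.
Qed.

Lemma relations_det m r : r != 0 -> ~ I (r *: \det (varmx n R) ^+ m).
Proof.
move=> r0 /(relations_sat hf r0); rewrite /relations mxeval_det => /eqP.
by rewrite expf_eq0 -[_ == 0]negbK -unitfE -unitmxE hY andbF.
Qed.

Let Dp_det j k m r : Dp j k (r *: \det (varmx n R) ^+ m) =
  partial hR j k r *: \det (varmx n R) ^+ m +
  (r * (\tr (B j k) *+ m)) *: \det (varmx n R) ^+ m.
Proof.
have hp := partial_der hR j k.
rewrite -!mul_mpolyC /Dp (derM (f := id) (lder_der _ hp)) lderC // lder_det //.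
by rewrite /= mulrA -mpolyCM.
Qed.

(** Either c generates a power of det over E, and then the multiples r det^m lying in c give a
    nonzero ideal of R stable under the partial derivations; or c has a zero Y M with M constant,
    which forces c into I. *)
Lemma stable_ideal_simple (c : {mpoly R[n * n]} -> Prop) : is_ideal c ->
  (forall q, I q -> c q) -> (exists2 s, c s & ~ I s) ->
  (forall q, c q -> c (D q)) -> (forall j k q, c q -> c (Dp j k q)) ->
  exists m, c (\det (varmx n R) ^+ m).
Proof.
move=> hc Ic [s cs Is] cD cDp; have [c0 cA cM] := hc.
have cZ r q : c q -> c (r *: q) by rewrite -mul_mpolyC; apply: cM.
have [[m hm]|hno] := classic (exists m, gen_ideal (map_mpoly f) c (\det (varmx n E) ^+ m)).
  exists m; set dm := \det (varmx n R) ^+ m.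
  pose J r := c (r *: dm).
  have [r r0 Jr] : exists2 r, r != 0 & J r.
    (* Otherwise a functional over R kills c in bounded degree but not det^m; over E it would have
       to kill det^m, which c generates there. *)
    apply: boolp.contrapT => hr.
    have [K0 hK0] := gen_ideal_functional hc hm.
    pose K := maxn K0 (msize dm).
    have [|||||lam [lam1 lam2]] // := @mpoly_separating_functional _ _ _ _ K hi hfr c dm.
    - exact: leq_maxr.
    - by move=> r r0 Jr; apply: hr; exists r.
    have := hK0 K (leq_maxl _ _) lam lam1.
    have -> : \det (varmx n E) ^+ m = map_mpoly f dm.
      by rewrite map_mpolyE_mxeval mxeval_det.
    under eq_bigr => u _ do rewrite mcoeff_map_mpoly -rmorphM.
    by rewrite -rmorph_sum => /eqP; apply/negP/(inj_rmorph_neq0 hf).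
  have hJ : is_ideal J.
    split=> [|x y hx hy|a x hx]; rewrite /J ?scale0r //.
      by rewrite scalerDl; apply: cA.
    by rewrite -scalerA; apply: cZ.
  suff : J 1 by rewrite /J scale1r.
  apply: (partials_simple (hR := hR) hchar hJ) => [j k x Jx|]; last by exists r.
  rewrite /J; have -> : partial hR j k x *: dm =
      Dp j k (x *: dm) - (x * (\tr (B j k) *+ m)) *: dm by rewrite Dp_det addrK.
  apply: idealB => //; first exact: cDp.
  by rewrite mulrC -scalerA; apply: cZ.
exfalso.
have hno' m : ~ gen_ideal (map_mpoly f) c (\det (varmx n E) ^+ m).
  by move=> h; apply: hno; exists m.
have [M [hM cMY]] := diff_ideal_point (c := f \o cR) hd hE hfd hconst hY hdY cD hno'.
apply: Is; have := cMY s cs; rewrite map_mx_comp.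
apply: (relations_mulr_inv hi hfr hf (M' := map_mx cR (invmx M))).
  by rewrite -map_mxM mulmxV // map_mx1.
by move=> q /Ic/cMY; rewrite map_mx_comp.
Qed.

(* The values at det^m of the functionals killing the relations of degree <= K form an ideal
   stable under all partial derivatives: the quotient module carries a connection. *)
Lemma good_reduction (S : comNzRingType) (sg : {rmorphism R -> S}) m :
  ~ gen_ideal (map_mpoly sg) I (\det (varmx n S) ^+ m).
Proof.
have hI := relations_ideal f Y; have [I0 IA IM] := hI.
have IZ r q : I q -> I (r *: q) by rewrite -mul_mpolyC; apply: IM.
move=> /(gen_ideal_functional hI) [K0 hK0].
set dm := \det (varmx n R) ^+ m; pose K := maxn K0 (msize dm).
have hdm : (msize dm <= K)%N by apply: leq_maxr.
pose pr (lam : 'X_{1..(n * n) < K} -> R) (q : {mpoly R[n * n]}) := \sum_u lam u * q@_u.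
have prD lam p q : pr lam (p + q) = pr lam p + pr lam q.
  by rewrite /pr -big_split; apply: eq_bigr => u _; rewrite mcoeffD mulrDr.
have pr0 lam : pr lam 0 = 0 by rewrite /pr big1 // => u _; rewrite mcoeff0 mulr0.
have prZ lam r q : pr lam (r *: q) = r * pr lam q.
  by rewrite /pr mulr_sumr; apply: eq_bigr => u _; rewrite mcoeffZ mulrCA.
have prX lam (u : 'X_{1..(n * n) < K}) : pr lam 'X_[u] = lam u.
  rewrite /pr (bigD1 u) //= mcoeffX eqxx mulr1 big1 ?addr0 // => v vu.
  by rewrite mcoeffX -val_eqE in vu *; rewrite eq_sym (negbTE vu) mulr0.
pose kills lam := forall q, I q -> (msize q <= K)%N -> pr lam q = 0.
pose J r := exists2 lam, kills lam & pr lam dm = r.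
suff [lam hlam e] : J 1.
  have := hK0 K (leq_maxl _ _) lam hlam.
  have -> : \det (varmx n S) ^+ m = map_mpoly sg dm.
    by rewrite map_mpolyE_mxeval mxeval_det.
  under eq_bigr => u _ do rewrite mcoeff_map_mpoly -rmorphM.
  by rewrite -rmorph_sum -/(pr lam dm) e rmorph1 => /eqP; rewrite oner_eq0.
apply: (partials_simple (hR := hR) hchar (J := J)).
- split=> [|x y [lam hx ex] [mu hy ey]|a x [lam hx ex]].
  + by exists (fun=> 0) => [q _ _|]; rewrite /pr big1 // => u _; rewrite mul0r.
  + exists (fun u => lam u + mu u); last first.
      by rewrite -ex -ey /pr -big_split; apply: eq_bigr => u _; rewrite mulrDl.
    move=> q Iq hq; rewrite -[RHS](addr0 0) -{1}(hx q Iq hq) -(hy q Iq hq) /pr -big_split.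
    by apply: eq_bigr => u _; rewrite mulrDl.
  + exists (fun u => a * lam u); last first.
      by rewrite -ex /pr mulr_sumr; apply: eq_bigr => u _; rewrite mulrA.
    move=> q Iq hq; rewrite -(mulr0 a) -(hx q Iq hq) /pr mulr_sumr.
    by apply: eq_bigr => u _; rewrite mulrA.
- move=> j k _ [lam hlam <-].
  have hp := partial_der hR j k.
  have hl := lder_der (B j k) hp.
  (* The dual connection on functionals, prescribed on monomials; [muE] gives it on all polynomials
     of bounded degree. *)
  pose mu (u : 'X_{1..(n * n) < K}) := partial hR j k (lam u) - pr lam (Dp j k 'X_[u]).
  have muE q : (msize q <= K)%N -> pr mu q = partial hR j k (pr lam q) - pr lam (Dp j k q).
    move=> hq; have hs : forall s : seq 'X_{1..(n * n) < K},
        pr mu (\sum_(u <- s) q@_u *: 'X_[u]) =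
        partial hR j k (pr lam (\sum_(u <- s) q@_u *: 'X_[u])) -
        pr lam (Dp j k (\sum_(u <- s) q@_u *: 'X_[u])).
      elim=> [|u s IH].
        by rewrite big_nil /Dp !(der0 (f := id) hl) !pr0 (der0 (f := id) hp) subr0.
      rewrite big_cons; set X := \sum_(_ <- s) _ in IH *.
      set x := q@_u *: 'X_[u].
      have e1 : Dp j k (x + X) = Dp j k x + Dp j k X := derD (f := id) hl x X.
      have e2 : pr mu x = partial hR j k (pr lam x) - pr lam (Dp j k x).
        rewrite /x !prZ !prX /mu (derM (f := id) hp).
        have -> : Dp j k (q@_u *: 'X_[u]) =
            (partial hR j k q@_u) *: 'X_[u] + q@_u *: Dp j k 'X_[u].
          by rewrite -!mul_mpolyC /Dp (derM (f := id) hl) lderC.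
        by rewrite (prD lam (_ *: 'X_[u])) !prZ prX /=; ring.
      rewrite (prD mu x X) (prD lam x X) e1 (prD lam (Dp j k x)) IH e2.
      by rewrite (derD (f := id) hp); ring.
    by rewrite [q](mpolywE hq); apply: hs.
  have kmu : kills mu.
    move=> q Iq hq; rewrite muE // hlam // hlam ?(der0 (f := id) hp) ?subr0 //.
      exact: relations_Dp.
    exact: msize_lder.
  (* The trace term compensates the derivative of det^m, so that the value at det^m is exactly the
     partial derivative of the old value. *)
  exists (fun u => mu u + (\tr (B j k) *+ m) * lam u).
    move=> q Iq hq; rewrite /pr; under eq_bigr => u _ do rewrite mulrDl -mulrA.
    by rewrite big_split /= -mulr_sumr -/(pr mu q) -/(pr lam q) kmu // hlam // mulr0 addr0.
  rewrite /pr; under eq_bigr => u _ do rewrite mulrDl -mulrA.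
  rewrite big_split /= -mulr_sumr -/(pr mu dm) -/(pr lam dm) muE //.
  rewrite -{2}[dm]scale1r Dp_det (der1 (f := id) hp) // scale0r add0r mul1r prZ.
  by rewrite subrK.
(* The ideal of values is nonzero: no nonzero multiple of det^m is a relation, as Y is
   invertible. *)
have [|||||lam [lam1 lam2]] // := @mpoly_separating_functional _ _ _ _ K hi hfr I dm.
  by move=> r r0; apply: relations_det.
by exists (pr lam dm) => //; exists lam.
Qed.
End GenericRelations.
(** * The differential Galois group and the specialization *)

Lemma derV (E : fieldType) (d : E -> E) x : isDerivation d -> d x^-1 = - (x^-1 * d x * x^-1).
Proof.
move=> hd; have [->|x0] := eqVneq x 0.
  by rewrite invr0 (der0 (f := id) hd) mulr0 oppr0.
have := der1 (f := id) hd (erefl 1); rewrite -(mulVf x0) (derM (f := id) hd) /= => /eqP.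
rewrite addr_eq0 => /eqP h; rewrite -[LHS]mulr1 -(divff x0) mulrA h; ring.
Qed.

Section FundamentalFractions.
Variables (R : comNzRingType) (F E : fieldType) (i : {rmorphism R -> F}) (j : {rmorphism F -> E}).
Variables (dF : F -> F) (dE : E -> E) (n : nat) (A : 'M[F]_n) (Y : 'M[E]_n).
Hypotheses (hi : injective i) (hfr : forall x, exists a b : R, b != 0 /\ x = i a / i b).
Hypothesis hE : is_PV dF A dE j Y.
Let f : {rmorphism R -> E} := j \o i.

Lemma pv_ind (P : E -> Prop) : (forall x, P (j x)) -> (forall a b, P (Y a b)) ->
  (forall x y, P x -> P y -> P (x + y)) -> (forall x, P x -> P (- x)) ->
  (forall x y, P x -> P y -> P (x * y)) -> (forall x, P x -> P (x^-1)) -> forall e, P e.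
Proof. by case: hE => _ _ _ _; apply. Qed.

Lemma pv_fractions e : exists a b, mxeval (j \o i) Y b != 0 /\
  e = mxeval (j \o i) Y a / mxeval (j \o i) Y b.
Proof.
rewrite -/f; have goodM b b' : mxeval f Y b != 0 -> mxeval f Y b' != 0 -> mxeval f Y (b * b') != 0.
  by move=> h h'; rewrite rmorphM; apply: mulf_neq0.
have poly q : exists a b, mxeval f Y b != 0 /\ mxeval f Y q = mxeval f Y a / mxeval f Y b.
  by exists q, 1; rewrite rmorph1 oner_neq0 divr1.
elim/pv_ind: e => [x|a b|_ _ [a [b [hb ->]]] [a' [b' [hb' ->]]]|_ [a [b [hb ->]]]|
    _ _ [a [b [hb ->]]] [a' [b' [hb' ->]]]|_ [a [b [hb ->]]]].
- have [a [b [b0 ->]]] := hfr x; exists a%:MP, b%:MP.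
  rewrite !mxeval_C /f /= fmorph_div; split=> //.
  by rewrite fmorph_eq0 inj_rmorph_neq0.
- by have := poly 'X_(mxvec_index a b); rewrite mxeval_X mxvecE.
- exists (a * b' + a' * b), (b * b'); split; first exact: goodM.
  by rewrite addf_div // !(rmorphD, rmorphM).
- by exists (- a), b; rewrite rmorphN mulNr.
- exists (a * a'), (b * b'); split; first exact: goodM.
  by rewrite mulf_div !rmorphM.
(* Since the inverse of 0 is 0 here, a zero numerator is handled apart. *)
- have [a0|a0] := eqVneq (mxeval f Y a) 0.
    by rewrite a0 mul0r invr0; have := poly 0; rewrite rmorph0.
  by exists b, a; rewrite invf_div.
Qed.
End FundamentalFractions.

Section GaloisCriterion.
Variables (R : comNzRingType) (F E : fieldType) (i : {rmorphism R -> F}) (j : {rmorphism F -> E}).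
Variables (dF : F -> F) (dE : E -> E) (n : nat) (A : 'M[F]_n) (Y : 'M[E]_n) (N N' : 'M[F]_n).
Hypotheses (hi : injective i) (hfr : forall x, exists a b : R, b != 0 /\ x = i a / i b).
Hypotheses (hE : is_PV dF A dE j Y) (hN : N *m N' = 1%:M) (hdN : map_mx dF N = 0).
Let f : {rmorphism R -> E} := j \o i.
Let W := Y *m map_mx j N.
Hypothesis hrel : forall q, mxeval (j \o i) Y q = 0 <-> mxeval (j \o i) (Y *m map_mx j N) q = 0.

Let hd : isDerivation dE. Proof. by case: hE => -[]. Qed.
Let hjd x : j (dF x) = dE (j x). Proof. by case: hE => -[_ h]. Qed.
Let hgen := pv_ind hE.

Let frac (X : 'M[E]_n) a b := mxeval f X a / mxeval f X b.
Let good b := mxeval f Y b != 0.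

Let good_W b : good b -> mxeval f W b != 0.
Proof. by apply: contra_neq => /hrel. Qed.

Let goodM b b' : good b -> good b' -> good (b * b').
Proof. by move=> h h'; rewrite /good rmorphM; apply: mulf_neq0. Qed.

Let fracD X a b a' b' : mxeval f X b != 0 -> mxeval f X b' != 0 ->
  frac X a b + frac X a' b' = frac X (a * b' + a' * b) (b * b').
Proof. by move=> h h'; rewrite /frac addf_div // !(rmorphD, rmorphM). Qed.

Let fracM X a b a' b' : frac X a b * frac X a' b' = frac X (a * a') (b * b').
Proof. by rewrite /frac mulf_div !rmorphM. Qed.

(** The map a(Y)/b(Y) to a(YN)/b(YN) is the candidate: one direction of [hrel] makes it well
    defined, the other keeps denominators nonzero. It is differential because YN solves the same
    system, N being constant. *)
Lemma galois_criterion : exists phi : {rmorphism E -> E},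
  [/\ bijective phi, forall x, phi (j x) = j x, forall e, phi (dE e) = dE (phi e)
    & map_mx phi Y = Y *m map_mx j N].
Proof.
rewrite -/W.
have /boolp.choice [ph hph] : forall e, exists v, exists a b,
    [/\ good b, e = frac Y a b & v = frac W a b].
  by move=> e; have [a [b [hb he]]] := pv_fractions hi hfr hE e; exists (frac W a b), a, b.
have phE a b : good b -> ph (frac Y a b) = frac W a b.
  move=> hb; have [a' [b' [hb' e ->]]] := hph (frac Y a b).
  have : mxeval f Y (a * b' - a' * b) = 0.
    rewrite rmorphB !rmorphM; apply/eqP; rewrite subr_eq0; apply/eqP.
    by move/eqP: e; rewrite /frac eqr_div // => /eqP.
  move/hrel; rewrite rmorphB !rmorphM => /eqP; rewrite subr_eq0 => /eqP e'.
  by apply/eqP; rewrite /frac eqr_div ?good_W // e'.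
have phD : zmod_morphism ph.
  move=> x y; have [a [b [hb ex _]]] := hph x; have [a' [b' [hb' ey _]]] := hph y.
  have fN X p q : - frac X p q = frac X (- p) q by rewrite /frac rmorphN mulNr.
  rewrite {}ex {}ey fN fracD // !phE ?goodM // fN fracD //; exact: good_W.
have phM : monoid_morphism ph.
  split=> [|x y].
    have e X : frac X 1 1 = 1 by rewrite /frac rmorph1 divr1.
    by rewrite -{1}(e Y) phE ?e // /good rmorph1 oner_neq0.
  have [a [b [hb ex _]]] := hph x; have [a' [b' [hb' ey _]]] := hph y.
  by rewrite {}ex {}ey fracM !phE ?goodM // fracM.
pose m1 := GRing.isZmodMorphism.Build E E ph phD.
pose m2 := GRing.isMonoidMorphism.Build E E ph phM.
pose phi : {rmorphism E -> E} := HB.pack ph m1 m2.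
have phi_ev q : phi (mxeval f Y q) = mxeval f W q.
  have e X : mxeval f X q = frac X q 1 by rewrite /frac rmorph1 divr1.
  by rewrite !e; apply: phE; rewrite /good rmorph1 oner_neq0.
have phij x : phi (j x) = j x.
  have [a [b [b0 ->]]] := hfr x; rewrite !fmorph_div.
  have c r : phi (f r) = f r by rewrite -(mxeval_C f Y) phi_ev !mxeval_C.
  by rewrite -[j (i a)]/(f a) -[j (i b)]/(f b) !c.
have phiY : map_mx phi Y = W.
  by apply/matrixP => a b; rewrite mxE -mxvecE -(mxeval_X f) phi_ev mxeval_X mxvecE.
have dW : map_mx dE W = map_mx j A *m W.
  case: hE => _ _ dY _ _; rewrite /W map_mx_derM // dY mulmxA.
  have -> : map_mx dE (map_mx j N) = 0.
    apply/matrixP => a b; rewrite !mxE -hjd.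
    by have /matrixP/(_ a b) := hdN; rewrite !mxE => ->; rewrite rmorph0.
  by rewrite mulmx0 addr0.
exists phi; split=> // [|e].
  (* The image contains the entries of Y = (Y N) N', hence everything. *)
  have surj e : exists e', phi e' = e.
    elim/hgen: e => [x|a b|_ _ [x <-] [y <-]|_ [x <-]|_ _ [x <-] [y <-]|_ [x <-]].
    - by exists (j x).
    - exists ((Y *m map_mx j N') a b).
      rewrite !mxE rmorph_sum; transitivity ((W *m map_mx j N') a b).
        rewrite [RHS]mxE; apply: eq_bigr => k _; rewrite rmorphM -phiY.
        by rewrite [in LHS]mxE phij [in RHS]mxE [in RHS]mxE.
      by rewrite /W -mulmxA -map_mxM hN map_mx1 mulmx1.
    - by exists (x + y); rewrite rmorphD.
    - by exists (- x); rewrite rmorphN.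
    - by exists (x * y); rewrite rmorphM.
    - by exists x^-1; rewrite fmorphV.
  have [g hg] := boolp.choice surj; exists g => // x.
  by apply: (fmorph_inj phi); rewrite hg.
elim/hgen: e => [x|a b|x y hx hy|x hx|x y hx hy|x hx].
- by rewrite -hjd !phij hjd.
- have /matrixP/(_ a b) := dW; rewrite mxE -phiY mxE [X in _ = X -> _]mxE => ->.
  case: hE => _ _ /matrixP/(_ a b) + _ _; rewrite mxE => ->; rewrite mxE rmorph_sum.
  by apply: eq_bigr => k _; rewrite rmorphM !mxE phij.
- by rewrite (derD (f := id) hd) !rmorphD hx hy (derD (f := id) hd).
- by rewrite (derN (f := id) hd) !rmorphN hx (derN (f := id) hd).
- by rewrite (derM (f := id) hd) rmorphD !rmorphM hx hy (derM (f := id) hd).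
- by rewrite (derV x hd) rmorphN !rmorphM !fmorphV hx (derV (phi x) hd).
Qed.
End GaloisCriterion.

(** * Carrying the equations of the Galois group through the specialization *)

Section Transport.
Variables (C : fieldType) (R : comNzRingType) (E E2 : fieldType) (n : nat).
Variables (cR : {rmorphism C -> R}) (f : {rmorphism R -> E}) (g : {rmorphism R -> E2}).
Variables (Y : 'M[E]_n) (T : 'M[E2]_n) (M : 'M[C]_n).
Local Notation RZ := {mpoly R[n * n]}.
Local Notation I := (relations f Y).
Hypothesis hfrac : forall e, exists a b, mxeval f Y b != 0 /\ e = mxeval f Y a / mxeval f Y b.

Let zR : {rmorphism R -> RZ} := @mpolyC (n * n) R.
Let zX q : {mpoly RZ[n * n]} := ltrans zR (varmx n R) q.

(* In {mpoly RZ[n * n]} = R[Z][X] the coefficients carry Z and the outer variables X, so zX q = q(ZX). *)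
Let gens (x : {mpoly RZ[n * n]}) := (exists2 q, I q & x = zX q) \/ (exists2 s, I s & x = s%:MP).
Let ideal_a := gen_ideal id gens.
Let a_ideal : is_ideal ideal_a := gen_idealP id gens.

Let a_der d (B : 'M[R]_n) : isDerivation d -> (forall q, I q -> I (lder d B q)) ->
  forall v, ideal_a v -> ideal_a (dcoef (lder d B) v).
Proof.
move=> hd hI; have hl := lder_der B hd.
apply: gen_ideal_der; first exact: dcoef_der.
move=> _ [[q Iq ->]|[s Is ->]]; apply: (@gen_ideal_in _ _ id gens).
  left; exists (lder d B q); first exact: hI.
  by rewrite /zX (ltrans_der (dE := lder d B) hd hl _ (lder_gen B hd)) // => x; apply: lderC.
by right; exists (lder d B s); [apply: hI | rewrite dcoefC].
Qed.

(** Putting Z = Y. Its kernel lies in [ideal_a], so a membership over E returns to R[Z][X] after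
    multiplication by some s(Z) outside I. *)
Let eps : {rmorphism {mpoly RZ[n * n]} -> {mpoly E[n * n]}} := map_mpoly (mxeval f Y).

Let eps_zX q : eps (zX q) = ltrans f Y q.
Proof.
rewrite /eps /= map_mpolyE_mxeval mxeval_ltrans /ltrans map_mx_comp mxeval_gen.
by apply: mxeval_eq => x /=; rewrite mxeval_C.
Qed.

Let epsC s : eps s%:MP = (mxeval f Y s)%:MP.
Proof. by rewrite /eps /= map_mpolyC ?rmorph0. Qed.

Let epsZ s x : eps (s *: x) = mxeval f Y s *: eps x.
Proof. by rewrite -!mul_mpolyC rmorphM /= epsC. Qed.

Let eps_ker x : eps x = 0 -> ideal_a x.
Proof.
move=> h; rewrite [x]mpolyE; apply: (ideal_sum _ a_ideal) => m _.
have [_ _ aM] := a_ideal; rewrite -mul_mpolyC mulrC; apply: aM.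
apply: (@gen_ideal_in _ _ id gens); right; exists x@_m => //.
by have /(congr1 (mcoeff m)) := h; rewrite mcoeff_map_mpoly mcoeff0.
Qed.

Let goodM s s' : mxeval f Y s != 0 -> mxeval f Y s' != 0 -> mxeval f Y (s * s') != 0.
Proof. by move=> h h'; rewrite rmorphM; apply: mulf_neq0. Qed.

Let clear_denominators (v : {mpoly E[n * n]}) :
  exists s w, mxeval f Y s != 0 /\ (mxeval f Y s) *: v = eps w.
Proof.
elim/mpolyind: v => [|e m p _ _ [s [w [s0 hw]]]].
  by exists 1, 0; rewrite !rmorph0 scaler0 rmorph1 oner_neq0.
have [a [b [b0 he]]] := hfrac e.
exists (b * s), ((s * a) *: 'X_[m] + b *: w); split; first exact: goodM.
have eX : eps 'X_[m] = 'X_[m] by rewrite /eps /= map_mpolyX.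
rewrite rmorphD /= !epsZ -hw eX scalerDr !scalerA he !rmorphM.
congr (_ *: _ + _); rewrite [mxeval f Y b * _]mulrC -mulrA; congr (_ * _).
by rewrite mulrC divfK.
Qed.

(** The multipliers s(Z) carrying p(X) into [ideal_a] form a stable ideal c, since the coefficients
    of p are constants; it contains I strictly, so it contains a power of det Z, which remains
    nonzero at Z = T. *)
Lemma transport_relations :
  (forall c : RZ -> Prop, is_ideal c -> (forall q, I q -> c q) ->
    (exists2 s, c s & ~ I s) ->
    (forall d B, isDerivation d -> (forall x, d (cR x) = 0) ->
      (forall q, I q -> I (lder d B q)) -> forall q, c q -> c (lder d B q)) ->
    exists m, c (\det (varmx n R) ^+ m)) ->
  T \in unitmx -> (forall q, I q -> mxeval g T q = 0) ->
  (forall q, I q -> mxeval g (T *m map_mx (g \o cR) M) q = 0) ->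
  forall p, gen_ideal (ltrans f Y) I (map_mpoly (f \o cR) p) -> mxeval idfun M p = 0.
Proof.
move=> simple hT hT0 hT1 p hp.
pose p0 : {mpoly RZ[n * n]} := map_mpoly (zR \o cR) p.
have ep0 : eps p0 = map_mpoly (f \o cR) p.
  rewrite /eps /p0 /= !map_mpolyE_mxeval mxeval_comp.
  have -> : map_mx (mxeval (@mpolyC (n * n) E \o mxeval f Y) (varmx n E)) (varmx n RZ) = varmx n E.
    exact: mxeval_gen.
  by apply: mxeval_eq => x /=; rewrite !mxeval_C /= mxeval_C.
pose c s := ideal_a (s%:MP * p0).
have [a0 aD aM] := a_ideal.
have hc : is_ideal c.
  rewrite /c; split=> [|x y|x y]; first by rewrite mpolyC0 mul0r.
    by rewrite mpolyCD mulrDl; apply: aD.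
  by rewrite mpolyCM -mulrA; apply: aM.
have [m cm] : exists m, c (\det (varmx n R) ^+ m).
  apply: simple => //.
  - move=> q Iq; rewrite /c mulrC; apply: aM; apply: (@gen_ideal_in _ _ id gens).
    by right; exists q.
  (* An element of c outside I: p is a combination over E of the q(Y X), and s clears the
     denominators of its coefficients. *)
  - suff [s [w [s0 [aw e]]]] : exists s w, mxeval f Y s != 0 /\
        ideal_a w /\ (mxeval f Y s) *: eps p0 = eps w.
      exists s; last by move=> h; rewrite h eqxx in s0.
      rewrite /c -[_ * p0](subrK w); apply: (aD) => //; apply: eps_ker.
      by rewrite rmorphB rmorphM /= epsC mul_mpolyC e subrr.
    rewrite ep0; apply: (hp (fun v => exists s w, mxeval f Y s != 0 /\
        ideal_a w /\ (mxeval f Y s) *: v = eps w)) => [|q Iq]; last first.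
      exists 1, (zX q); rewrite rmorph1 scale1r eps_zX oner_neq0; split=> //; split=> //.
      by apply: (@gen_ideal_in _ _ id gens); left; exists q.
    split=> [|x y [s [w [s0 [aw e]]]] [s' [w' [s0' [aw' e']]]]|a x [s [w [s0 [aw e]]]]].
    + by exists 1, 0; rewrite scaler0 rmorph0 rmorph1 oner_neq0.
    + exists (s * s'), (s'%:MP * w + s%:MP * w'); split; first exact: goodM.
      split; first by apply: (aD); apply: aM.
      rewrite rmorphD !rmorphM /= !epsC -e -e' !mul_mpolyC scalerDr !scalerA.
      by rewrite [X in _ = X *: x + _]mulrC.
    + have [s' [w' [s0' e']]] := clear_denominators a.
      exists (s' * s), (w' * w); split; first exact: goodM.
      by split; [apply: aM | rewrite !rmorphM /= -e -e' -scalerAl -scalerAr scalerA].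
  move=> d B hd hdc hI q cq; have hl := lder_der B hd.
  have := a_der hd hI cq; rewrite (derM (f := id) (dcoef_der _ hl)) dcoefC //.
  suff -> : dcoef (lder d B) p0 = 0 by rewrite mulr0 addr0.
  apply/mpolyP => k; rewrite mcoeff_dcoef // mcoeff_map_mpoly mcoeff0 /= lderC //.
  by rewrite hdc mpolyC0.
pose N := map_mx (g \o cR) M.
(* Z goes to T and X to the constant matrix; the two kinds of generators of [ideal_a] vanish by
   [hT1] and [hT0]. *)
pose theta := mxeval (mxeval g T : {rmorphism RZ -> E2}) N.
have : theta ((\det (varmx n R) ^+ m)%:MP * p0) = 0.
  apply: (gen_ideal_map (h := theta) (zero_ideal E2) _ cm) => _ [[q Iq ->]|[s Is ->]].
    rewrite /theta /= /zX mxeval_ltrans mxeval_gen -[RHS](hT1 q Iq).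
    by apply: mxeval_eq => x /=; rewrite mxeval_C.
  by rewrite /theta /= mxeval_C; apply: hT0.
rewrite /theta rmorphM /= mxeval_C /= mxeval_det => /eqP; rewrite mulf_eq0 expf_eq0.
rewrite -[\det T == 0]negbK -unitfE -unitmxE hT andbF /= => /eqP e.
apply: (fmorph_inj (g \o cR)); rewrite rmorph0 -[RHS]e mxeval_comp.
rewrite /p0 map_mpolyE_mxeval mxeval_comp mxeval_gen.
by apply: mxeval_eq => x /=; rewrite mxeval_C /= [in RHS]mxeval_C.
Qed.
End Transport.

(** * Constants of C(z) and the final assembly *)

Lemma deriv_eq0_const (C : fieldType) (p : {poly C}) :
  [pchar C] =i pred0 -> p^`() = 0 -> p = (p`_0)%:P.
Proof.
move=> hchar h; apply/polyP => -[|i]; rewrite coefC //=; apply/eqP.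
have /eqP := congr1 (fun q : {poly C} => q`_i) h; rewrite coef_deriv coef0.
by rewrite -[_ *+ i.+1]mulr_natl mulf_eq0 ((pcharf0P C).1 hchar).
Qed.

(** In lowest terms the denominator divides its own derivative, which has smaller degree and so
    vanishes; then the derivative of the numerator vanishes too. *)
Lemma poly_frac_constants (C F : fieldType) (dF : F -> F) (i : {rmorphism {poly C} -> F}) :
  [pchar C] =i pred0 -> is_diff_frac_field (@deriv C) dF i ->
  forall x, dF x = 0 -> exists c : C, x = i c%:P.
Proof.
move=> hchar [hdF [hi [hid hfr]]] x dx; have [a [b [b0 xab]]] := hfr x.
pose g := gcdp a b; pose a' := a %/ g; pose b' := b %/ g.
have g0 : g != 0 by rewrite gcdp_eq0 (negbTE b0) andbF.
have hab : a = a' * g /\ b = b' * g by rewrite !divpK ?dvdp_gcdl ?dvdp_gcdr.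
have b'0 : b' != 0 by apply: contraNneq b0 => h; rewrite hab.2 h mul0r.
have ib : i b' != 0 := inj_rmorph_neq0 hi b'0.
have xab' : x = i a' / i b'.
  by rewrite xab hab.1 hab.2 !rmorphM -mulf_div divff ?mulr1 // inj_rmorph_neq0.
have e : a'^`() * b' = a' * b'^`().
  apply: hi; rewrite !rmorphM !hid; have -> : i a' = x * i b' by rewrite xab' divfK.
  by rewrite (derM (f := id) hdF) dx mul0r add0r mulrAC.
have cop : coprimep b' a' by rewrite coprimep_sym coprimep_div_gcd // b0 orbT.
have db' : b'^`() = 0.
  have : b' %| b'^`() by rewrite -(Gauss_dvdpr _ cop) -e dvdp_mulIr.
  by apply: contraTeq => h; rewrite gtNdvdp // lt_size_deriv.
have da' : a'^`() = 0.
  by move/eqP: e; rewrite db' mulr0 mulf_eq0 (negbTE b'0) orbF => /eqP.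
have [ea eb] := (deriv_eq0_const hchar da', deriv_eq0_const hchar db').
have c0 : b'`_0 != 0 by apply: contraNneq b'0 => h; rewrite eb h polyC0.
exists (a'`_0 / b'`_0); rewrite xab' ea eb !coefC /= polyCM rmorphM; congr (_ * _).
apply: (mulIf (inj_rmorph_neq0 hi (x := (b'`_0)%:P) _)); first by rewrite polyC_eq0.
by rewrite mulVf -?rmorphM -?polyCM ?mulVf ?rmorph1 // inj_rmorph_neq0 // polyC_eq0.
Qed.
Theorem theorem4
  (C : closedFieldType) (hC : [pchar C] =i pred0) (l n : nat)
  (* R1 = C{t_1..t_l} with derivation dR1 *)
  (R1 : comNzRingType) (cR1 : {rmorphism C -> R1}) (dR1 : R1 -> R1) (t : 'I_l -> R1)
  (hR1 : is_diff_poly_ring cR1 dR1 t)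
  (* F1 = C<t_1..t_l>, its differential fraction field *)
  (F1 : fieldType) (dF1 : F1 -> F1) (i1 : {rmorphism R1 -> F1})
  (hF1 : is_diff_frac_field dR1 dF1 i1)
  (* F2 = C(z), differential fraction field of R2 = C[z] with d/dz *)
  (F2 : fieldType) (dF2 : F2 -> F2) (i2 : {rmorphism {poly C} -> F2})
  (hF2 : is_diff_frac_field (@deriv C) dF2 i2)
  (A : 'M[R1]_n)
  (* surjective specialization sigma : R1 -> C[z] *)
  (sigma : {rmorphism R1 -> {poly C}})
  (hsigma : diff_C_hom cR1 (@polyC C) dR1 (@deriv C) sigma)
  (hsurj : forall p : {poly C}, exists r : R1, sigma r = p)
  (* a Picard-Vessiot extension of F1 for y' = A(t) y *)
  (E1 : fieldType) (dE1 : E1 -> E1) (j1 : {rmorphism F1 -> E1}) (Y1 : 'M[E1]_n)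
  (hE1 : is_PV dF1 (map_mx i1 A) dE1 j1 Y1)
  (* a Picard-Vessiot extension of F2 for y' = A(sigma(t)) y *)
  (E2 : fieldType) (dE2 : E2 -> E2) (j2 : {rmorphism F2 -> E2}) (Y2 : 'M[E2]_n)
  (hE2 : is_PV dF2 (map_mx i2 (map_mx sigma A)) dE2 j2 Y2) :
  exists P : 'M[C]_n, P \in unitmx /\
    forall M : 'M[C]_n,
      in_gal (fun c => i2 c%:P) dE2 j2 Y2 M ->
      in_gal (fun c => i1 (cR1 c)) dE1 j1 Y1 (invmx P *m M *m P).
Proof.
have [hd1 hdc] := hR1.1; have [hdF1 [hi1 [hid1 hfr1]]] := hF1.
have [[hdE1 hjd1] hY1 hdY1 hcE1 _] := hE1; have [[hdE2 hjd2] hY2 hdY2 hcE2 _] := hE2.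
have [hdF2 [_ [hid2 _]]] := hF2; have [hsc hsd] := hsigma.
pose f : {rmorphism R1 -> E1} := j1 \o i1.
pose g : {rmorphism R1 -> E2} := j2 \o i2 \o sigma.
have hf : injective f by move=> x y /= /fmorph_inj/hi1.
have hfd x : dE1 (f x) = f (dR1 x) by rewrite /f /= -hjd1 hid1.
have hgd x : dE2 (g x) = g (dR1 x) by rewrite /g /= -hjd2 -hid2 hsd.
have hdYf : map_mx dE1 Y1 = map_mx f A *m Y1 by rewrite hdY1 -map_mx_comp.
have hdYg : map_mx dE2 Y2 = map_mx g A *m Y2 by rewrite hdY2 -!map_mx_comp.
have hconst1 e : dE1 e = 0 -> exists c, e = f (cR1 c).
  by move=> /hcE1 [x [/(frac_constants hC hR1 hF1) [c ->] ->]]; exists c.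
have hconst2 e : dE2 e = 0 -> exists c, e = (g \o cR1) c.
  by move=> /hcE2 [x [/(poly_frac_constants hC hF2) [c ->] ->]]; exists c; rewrite /g /= hsc.
have [B [hB0 hB]] := connection_exists hR1 A.
have ID q : relations f Y1 q -> relations f Y1 (lder dR1 A q).
  exact: (relations_D hR1 hdE1 hfd hdYf).
(* By [good_reduction] no power of det lies in the specialized ideal of relations, so this ideal has
   a zero Y2 P with P constant and invertible. *)
have [P [hP hPI]] := diff_ideal_point (c := g \o cR1) hd1 hdE2 hgd hconst2 hY2 hdYg ID
  (fun m => good_reduction hC hi1 hfr1 hB0 hB hdE1 hf hfd hY1 hdYf (sg := g) (m := m)).
exists P; split=> // M [phi [_ phij _ phiY]].
have {}phiY : map_mx phi Y2 = Y2 *m map_mx (g \o cR1) M.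
  by rewrite phiY; congr (_ *m _); apply: eq_map_mx => c; rewrite /g /= hsc.
have hM : M \in unitmx.
  have : map_mx phi Y2 \in unitmx by rewrite map_unitmx.
  by rewrite phiY unitmx_mul map_unitmx => /andP[].
pose N := invmx P *m M *m P; rewrite -/N.
have hN : N \in unitmx by rewrite !unitmx_mul unitmx_inv hP hM.
pose T := Y2 *m map_mx (g \o cR1) P.
have hT : T \in unitmx by rewrite unitmx_mul hY2 map_unitmx.
(* As P N = M P, phi sends T = Y2 P to T N; it fixes the coefficients, so applying it to q(T) = 0
   gives q(T N) = 0. *)
have hTN q : relations f Y1 q -> mxeval g (T *m map_mx (g \o cR1) N) q = 0.
  have -> : T *m map_mx (g \o cR1) N = map_mx phi T.
    have e : P *m N = M *m P by rewrite /N !mulmxA mulmxV // mul1mx.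
    rewrite /T map_mxM phiY -!mulmxA -map_mxM e map_mxM; congr (_ *m (_ *m _)).
    by rewrite -map_mx_comp; apply: eq_map_mx => c; rewrite /g /= phij.
  move=> /hPI /(congr1 phi); rewrite rmorph0 mxeval_comp => <-.
  by apply: mxeval_eq => x; rewrite /g /= phij.
have hN1 : forall q, relations f Y1 q -> mxeval f (Y1 *m map_mx (f \o cR1) N) q = 0.
  apply: (ltrans_vanish (c := f \o cR1) hd1 hdE1 hfd hconst1 hdYf ID).
  apply: (transport_relations (pv_fractions hi1 hfr1 hE1) _ hT hPI hTN) => c hc Ic hs hD.
  apply: (stable_ideal_simple hC (hR := hR1) hi1 hfr1 (A := A) (B := B) hdE1 hf hfd hY1 hdYf
    hconst1 hc Ic hs).
    by move=> q; apply: hD.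
  move=> j k q; apply: hD; first exact: partial_der.
    exact: partial_const.
  exact: (relations_Dp hi1 hfr1 hB0 hB hdE1 hf hfd hdYf).
have NN : map_mx cR1 N *m map_mx cR1 (invmx N) = 1%:M by rewrite -map_mxM mulmxV // map_mx1.
(* The criterion needs the same relations for Y1 and Y1 N; the converse inclusion follows from the
   invertibility of N. *)
have hN2 : forall q, mxeval f (Y1 *m map_mx f (map_mx cR1 N)) q = 0 -> relations f Y1 q.
  apply: (relations_mulr_inv hi1 hfr1 hf NN) => q /hN1.
  by rewrite map_mx_comp.
have [|||phi1 [h1 h2 h3 h4]] := galois_criterion (N := map_mx (i1 \o cR1) N)
    (N' := map_mx (i1 \o cR1) (invmx N)) hi1 hfr1 hE1.
- by rewrite -map_mxM mulmxV // map_mx1.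
- by apply/matrixP => a b; rewrite !mxE /= -hid1 hdc rmorph0.
- move=> q; rewrite -map_mx_comp; split=> [/hN1 //|h]; apply: hN2.
  by rewrite -map_mx_comp.
by exists phi1; split=> //; rewrite h4 -map_mx_comp.
Qed.
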